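(* Let $H$ and $C$ be Hopf algebras over a field $k$ with a Hopf pairing $\phi\colon C\otimes H\to k$, and let $D(H)$ be the corresponding quantum double. Then the subalgebra $H\otimes C\subset D(H)^*$ is a sub-bimodule of the $D(H)$-bimodule $D(H)^*$.
   Context: A Hopf pairing satisfies $\phi(c,hh')=\phi(c_{(1)},h)\phi(c_{(2)},h')$, $\phi(cc',h)=\phi(c,h_{(1)})\phi(c',h_{(2)})$, $\phi(1,h)=\varepsilon(h)$, $\phi(c,1)=\varepsilon(c)$, $\phi(Sc,h)=\phi(c,Sh)$. The motivating case is $C$ the finite dual of $H$ with the evaluation pairing. The quantum double $D(H)$ is the Hopf algebra which is $C\otimes H$ with the tensor product coalgebra structure, contains $C^{\mathrm{op}}$ and $H$ as subalgebras (so $c\cdot c'=c'c$ for $c,c'\in C$ and $h\cdot h'=hh'$ for $h,h'\in H$), and satisfies $$h\cdot c=c_{(2)}\cdot h_{(2)}\,\phi(c_{(1)},Sh_{(1)})\,\phi(c_{(3)},h_{(3)}).$$ The dual $D(H)^*$ is an algebra with the product dual to the coproduct of $D(H)$, and a $D(H)$-bimodule via $(x\blacktriangleright f)(y)=f(yx)$ and $(f\blacktriangleleft x)(y)=f(xy)$ for $x,y\in D(H)$, $f\in D(H)^*$. The algebra $H\otimes C$ (with the tensor product algebra structure) is regarded as a subalgebra of $D(H)^*$ through the pairing $\langle c\cdot h,\ \bar h\otimes\bar c\rangle=\phi(c,\bar h)\,\phi(\bar c,h)$ for $c,\bar c\in C$, $h,\bar h\in H$. *)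

(* Defs.v *)
From HB Require Import structures.
From mathcomp Require Import all_boot all_algebra boolp.

Set Implicit Arguments.
Unset Strict Implicit.
Unset Printing Implicit Defensive.

Import GRing.Theory.
Local Open Scope ring_scope.
Local Open Scope quotient_scope.

Section Linear.
Variable k : fieldType.

Definition islin (V W : lmodType k) (f : V -> W) : Prop := linear f.

Variables V W U : lmodType k.

Definition bilin (F : V -> W -> U) : Type :=
  ((forall w, islin (F^~ w)) * (forall v, islin (F v)))%type.

Lemma lin_add (f : V -> W) : islin f -> {morph f : x y / x + y}.
Proof. by move=> h x y; have := h 1 x y; rewrite !scale1r. Qed.

Lemma lin_0 (f : V -> W) : islin f -> f 0 = 0.
Proof. by move=> h; apply: (addrI (f 0)); rewrite -lin_add // !addr0. Qed.

Lemma lin_scale (f : V -> W) : islin f -> forall a, {morph f : x / a *: x}.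
Proof. by move=> h a x; have := h a x 0; rewrite !addr0 lin_0 // addr0. Qed.

End Linear.

Section TensorDef.
Variables (k : fieldType) (V W : lmodType k).

(* Finite formal sums of pairs; scalars can be absorbed in either entry. *)
Inductive tensor_eq : seq (V * W) -> seq (V * W) -> Prop :=
| TensorRefl s : tensor_eq s s
| TensorSym s t : tensor_eq s t -> tensor_eq t s
| TensorTrans s t u : tensor_eq s t -> tensor_eq t u -> tensor_eq s u
| TensorCat s s' t t' :
    tensor_eq s s' -> tensor_eq t t' -> tensor_eq (s ++ t) (s' ++ t')
| TensorComm s t : tensor_eq (s ++ t) (t ++ s)
| TensorZero w : tensor_eq [:: (0, w)] [::]
| TensorAddl v v' w : tensor_eq [:: (v + v', w)] [:: (v, w); (v', w)]
| TensorAddr v w w' : tensor_eq [:: (v, w + w')] [:: (v, w); (v, w')]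
| TensorScale a v w : tensor_eq [:: (a *: v, w)] [:: (v, a *: w)].

Definition tensor_eqb s t : bool := `[< tensor_eq s t >].

Lemma tensor_eqbP s t : reflect (tensor_eq s t) (tensor_eqb s t).
Proof. exact: asboolP. Qed.

Lemma tensor_eqb_refl : reflexive tensor_eqb.
Proof. by move=> s; apply/tensor_eqbP/TensorRefl. Qed.

Lemma tensor_eqb_sym : symmetric tensor_eqb.
Proof.
by move=> s t; apply/tensor_eqbP/tensor_eqbP; apply: TensorSym.
Qed.

Lemma tensor_eqb_trans : transitive tensor_eqb.
Proof.
by move=> s t u /tensor_eqbP h1 /tensor_eqbP h2; apply/tensor_eqbP/(TensorTrans h1).
Qed.

Canonical tensor_equiv :=
  EquivRel tensor_eqb tensor_eqb_refl tensor_eqb_sym tensor_eqb_trans.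

Definition tensor : Type := {eq_quot tensor_equiv}.
HB.instance Definition _ := Choice.on tensor.

Definition tensor_terms (x : tensor) : seq (V * W) := repr (x : {eq_quot tensor_equiv}).
Definition tensor_of (s : seq (V * W)) : tensor := \pi_({eq_quot tensor_equiv}) s.

Lemma tensor_termsK x : tensor_of (tensor_terms x) = x.
Proof. exact: reprK. Qed.

Lemma tensor_of_eq s t : tensor_eq s t -> tensor_of s = tensor_of t.
Proof. by move=> st; apply/eqmodP/tensor_eqbP. Qed.

Lemma tensor_terms_of s : tensor_eq (tensor_terms (tensor_of s)) s.
Proof. by apply/tensor_eqbP; apply/eqmodP; rewrite reprK. Qed.

Definition tensor_add (x y : tensor) := tensor_of (tensor_terms x ++ tensor_terms y).
Definition tensor_opp (x : tensor) :=
  tensor_of [seq (- p.1, p.2) | p <- tensor_terms x].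
Definition tensor_scale (a : k) (x : tensor) :=
  tensor_of [seq (a *: p.1, p.2) | p <- tensor_terms x].

Lemma tensor_of_cat s t : tensor_of (s ++ t) = tensor_add (tensor_of s) (tensor_of t).
Proof.
by apply: tensor_of_eq; apply: TensorCat; apply/TensorSym/tensor_terms_of.
Qed.

Lemma tensor_eq_map (g : V -> V) : {morph g : x y / x + y} ->
  (forall a, {morph g : x / a *: x}) -> forall s t, tensor_eq s t ->
  tensor_eq [seq (g p.1, p.2) | p <- s] [seq (g p.1, p.2) | p <- t].
Proof.
move=> gD gZ s t; elim=> //= {s t}.
- by move=> *; apply: TensorRefl.
- by move=> s t _; apply: TensorSym.
- by move=> s t u _ h1 _; apply: TensorTrans.
- by move=> s s' t t' _ h1 _ h2; rewrite !map_cat; apply: TensorCat.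
- by move=> s t; rewrite !map_cat; apply: TensorComm.
- by move=> w; rewrite -(scale0r 0) gZ scale0r; apply: TensorZero.
- by move=> v v' w; rewrite gD; apply: TensorAddl.
- by move=> v w w'; apply: TensorAddr.
- by move=> a v w; rewrite gZ; apply: TensorScale.
Qed.

Lemma tensor_of_opp s :
  tensor_opp (tensor_of s) = tensor_of [seq (- p.1, p.2) | p <- s].
Proof.
apply: tensor_of_eq; apply: tensor_eq_map (tensor_terms_of s).
  exact: opprD.
by move=> a x; rewrite scalerN.
Qed.

Lemma tensor_of_scale a s :
  tensor_scale a (tensor_of s) = tensor_of [seq (a *: p.1, p.2) | p <- s].
Proof.
apply: tensor_of_eq; apply: tensor_eq_map (tensor_terms_of s).
  exact: scalerDr.
by move=> b x; rewrite !scalerA mulrC.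
Qed.

Lemma tensor_ofP (P : tensor -> Prop) : (forall s, P (tensor_of s)) -> forall x, P x.
Proof. by move=> h x; rewrite -(tensor_termsK x). Qed.

Lemma tensor_addA : associative tensor_add.
Proof.
elim/tensor_ofP=> s; elim/tensor_ofP=> t; elim/tensor_ofP=> u.
by rewrite -!tensor_of_cat catA.
Qed.

Lemma tensor_addC : commutative tensor_add.
Proof.
elim/tensor_ofP=> s; elim/tensor_ofP=> t.
by rewrite -!tensor_of_cat; apply/tensor_of_eq/TensorComm.
Qed.

Lemma tensor_add0 : left_id (tensor_of [::]) tensor_add.
Proof. by elim/tensor_ofP=> s; rewrite -tensor_of_cat. Qed.

Lemma tensor_addN : left_inverse (tensor_of [::]) tensor_opp tensor_add.
Proof.
elim/tensor_ofP; elim=> [|[v w] s IHs].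
  by rewrite tensor_of_opp -tensor_of_cat.
rewrite tensor_of_opp /= -cat1s -[(v, w) :: s]cat1s !tensor_of_cat.
rewrite -tensor_addA [tensor_add _ (tensor_add _ (tensor_of s))]tensor_addA.
rewrite [tensor_add _ (tensor_of [:: (v, w)])]tensor_addC.
rewrite -[tensor_add (tensor_add _ _) _]tensor_addA -tensor_of_opp IHs.
rewrite tensor_addA [tensor_add _ (tensor_of [::])]tensor_addC tensor_add0.
rewrite -tensor_of_cat /= -(tensor_of_eq (TensorAddl _ _ _)) addNr.
exact/tensor_of_eq/TensorZero.
Qed.

HB.instance Definition _ :=
  GRing.isZmodule.Build tensor tensor_addA tensor_addC tensor_add0 tensor_addN.

Lemma tensor_of_nil : tensor_of [::] = 0. Proof. by []. Qed.

Lemma tensor_ofD s t : tensor_of (s ++ t) = tensor_of s + tensor_of t.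
Proof. exact: tensor_of_cat. Qed.

Lemma tensor_scaleA a b x : tensor_scale a (tensor_scale b x) = tensor_scale (a * b) x.
Proof.
elim/tensor_ofP: x => s; rewrite !tensor_of_scale -map_comp; congr tensor_of.
by apply: eq_map => p /=; rewrite scalerA.
Qed.

Lemma tensor_scale1 : left_id 1 tensor_scale.
Proof.
elim/tensor_ofP=> s; rewrite tensor_of_scale; congr tensor_of.
by rewrite -[RHS]map_id; apply: eq_map => -[v w] /=; rewrite scale1r.
Qed.

Lemma tensor_scaleDr : right_distributive tensor_scale +%R.
Proof.
move=> a; elim/tensor_ofP=> s; elim/tensor_ofP=> t.
by rewrite -tensor_ofD !tensor_of_scale map_cat tensor_ofD.
Qed.

Lemma tensor_scaleDl x : {morph tensor_scale^~ x : a b / a + b}.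
Proof.
move=> a b; elim/tensor_ofP: x => s; rewrite !tensor_of_scale.
elim: s => [|[v w] s IHs]; first by rewrite /= tensor_of_nil addr0.
rewrite /= -cat1s -[(a *: v, w) :: _]cat1s -[(b *: v, w) :: _]cat1s.
rewrite !tensor_ofD IHs scalerDl (tensor_of_eq (TensorAddl _ _ _)).
by rewrite -[[:: _; _]]cat1s tensor_ofD addrACA.
Qed.

HB.instance Definition _ := GRing.Zmodule_isLmodule.Build k tensor
  tensor_scaleA tensor_scale1 tensor_scaleDr tensor_scaleDl.

Definition ten (v : V) (w : W) : tensor := tensor_of [:: (v, w)].

Lemma tenE x : x = \sum_(p <- tensor_terms x) ten p.1 p.2.
Proof.
rewrite -[LHS]tensor_termsK; elim: (tensor_terms x) => [|[v w] s IHs].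
  by rewrite big_nil.
by rewrite big_cons -IHs -cat1s tensor_ofD.
Qed.

Lemma ten_linearl w : linear (ten^~ w).
Proof.
move=> a v v'; rewrite /ten (tensor_of_eq (TensorAddl _ _ _)).
rewrite -[[:: _; _]]cat1s tensor_ofD; congr (_ + _).
by rewrite -[[:: (v, w)]]/([:: _]) [RHS]tensor_of_scale.
Qed.

Lemma ten_linearr v : linear (ten v).
Proof.
move=> a w w'; rewrite /ten (tensor_of_eq (TensorAddr _ _ _)).
rewrite -[[:: _; _]]cat1s tensor_ofD; congr (_ + _).
by rewrite -(tensor_of_eq (TensorScale _ _ _)) [RHS]tensor_of_scale.
Qed.

Section Lift.
Variable U : lmodType k.

(* The linear map induced by a bilinear map F (junk when F is not bilinear,
   since it then depends on the representative chosen for x). *)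
Definition tensor_lift (F : V -> W -> U) (x : tensor) : U :=
  \sum_(p <- tensor_terms x) F p.1 p.2.

Variables (F : V -> W -> U).
Hypothesis Fbil : bilin F.

Lemma tensor_eq_lift s t : tensor_eq s t ->
  \sum_(p <- s) F p.1 p.2 = \sum_(p <- t) F p.1 p.2.
Proof.
elim=> //= {s t}.
- by move=> s t u _ -> _ ->.
- by move=> s s' t t' _ h1 _ h2; rewrite !big_cat /= h1 h2.
- by move=> s t; rewrite !big_cat /= addrC.
- by move=> w; rewrite big_seq1 big_nil /= (lin_0 (Fbil.1 w)).
- by move=> v v' w; rewrite big_seq1 !big_cons big_nil addr0 /= (lin_add (Fbil.1 w)).
- by move=> v w w'; rewrite big_seq1 !big_cons big_nil addr0 /= (lin_add (Fbil.2 v)).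
- by move=> a v w; rewrite !big_seq1 /= (lin_scale (Fbil.1 w)) (lin_scale (Fbil.2 v)).
Qed.

Lemma tensor_lift_of s : tensor_lift F (tensor_of s) = \sum_(p <- s) F p.1 p.2.
Proof. exact/tensor_eq_lift/tensor_terms_of. Qed.

Lemma tensor_liftE v w : tensor_lift F (ten v w) = F v w.
Proof. by rewrite tensor_lift_of big_seq1. Qed.

Lemma tensor_lift_linear : linear (tensor_lift F).
Proof.
move=> a; elim/tensor_ofP=> s; elim/tensor_ofP=> t.
rewrite [a *: _]tensor_of_scale -tensor_ofD !tensor_lift_of big_cat big_map /=.
rewrite scaler_sumr; congr (_ + _); apply: eq_bigr => p _.
by rewrite (lin_scale (Fbil.1 _)).
Qed.

End Lift.
End TensorDef.

Notation "v \ox w" := (ten v w) (at level 40, left associativity) : ring_scope.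

(* Sweedler's notation: \sw_(a, b <- x) E is the value at x of the linear
   map induced by the bilinear map sending (a, b) to E. *)
Notation "\sw_ ( a , b <- x ) E" := (tensor_lift (fun a b => E) x)
  (at level 41, E at level 41, a name, b name, x at level 50,
   format "'[' \sw_ ( a ,  b  <-  x ) '/  '  E ']'") : ring_scope.

(* Keep conversion from unfolding the quotient construction. *)
Strategy 1000 [tensor tensor_of tensor_add tensor_opp tensor_scale ten
                 tensor_lift].

Section LinearLemmas.
Variable k : fieldType.
Implicit Types V W U M : lmodType k.

Lemma lin_id V : islin (fun x : V => x). Proof. by []. Qed.

Lemma lin_addf V U (f g : V -> U) :
  islin f -> islin g -> islin (fun x => f x + g x).
Proof. by move=> hf hg a x y; rewrite hf hg scalerDr addrACA. Qed.

Lemma lin_scalef V U (f : V -> U) b : islin f -> islin (fun x => b *: f x).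
Proof. by move=> hf a x y; rewrite hf scalerDr !scalerA mulrC. Qed.

Lemma lin_scalel V U (f : V -> k^o) (u : U) : islin f -> islin (fun x => (f x : k) *: u).
Proof. by move=> hf a x y; rewrite hf scalerDl scalerA. Qed.

Lemma lin_comp V W U (g : {linear W -> U}) (f : V -> W) :
  islin f -> islin (fun x => g (f x)).
Proof. by move=> hf a x y; rewrite hf linearP. Qed.

Lemma lin_compf V W U (g : W -> U) (f : V -> W) :
  islin g -> islin f -> islin (fun x => g (f x)).
Proof. by move=> hg hf a x y; rewrite hf hg. Qed.

Lemma lin_mull V (A : algType k) (f : V -> A) b :
  islin f -> islin (fun x => f x * b).
Proof. by move=> hf a x y; rewrite hf mulrDl scalerAl. Qed.

Lemma lin_mulr V (A : algType k) (f : V -> A) b :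
  islin f -> islin (fun x => b * f x).
Proof. by move=> hf a x y; rewrite hf mulrDr scalerAr. Qed.

Lemma lin_mulkl V (f : V -> k^o) (b : k) :
  islin f -> islin (fun x => (f x : k) * b : k^o).
Proof. by move=> hf a x y; rewrite hf mulrDl -mulrA. Qed.

Lemma lin_mulkr V (f : V -> k^o) (b : k) :
  islin f -> islin (fun x => b * (f x : k) : k^o).
Proof. by move=> hf a x y; rewrite hf mulrDr mulrCA. Qed.

Lemma lin_tenl V W U (f : U -> V) (w : W) :
  islin f -> islin (fun x => f x \ox w).
Proof. by move=> hf a x y; rewrite hf ten_linearl. Qed.

Lemma lin_tenr V W U (f : U -> W) (v : V) :
  islin f -> islin (fun x => v \ox f x).
Proof. by move=> hf a x y; rewrite hf ten_linearr. Qed.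

Lemma lin_liftF V W U M (F : M -> V -> W -> U) t :
  (forall v w, islin (fun x => F x v w)) -> islin (fun x => tensor_lift (F x) t).
Proof.
move=> hF a x y; rewrite /tensor_lift scaler_sumr -big_split /=.
by apply: eq_bigr => p _; rewrite hF.
Qed.

Lemma lin_lift V W U M (F : V -> W -> U) (g : M -> tensor V W) :
  bilin F -> islin g -> islin (fun x => tensor_lift F (g x)).
Proof. by move=> hF hg a x y; rewrite hg tensor_lift_linear. Qed.

Lemma eq_lift V W U (F G : V -> W -> U) x :
  (forall v w, F v w = G v w) -> tensor_lift F x = tensor_lift G x.
Proof. by move=> h; apply: eq_bigr => p _. Qed.

Lemma lift_push V W U M (g : U -> M) (F : V -> W -> U) x : islin g ->
  g (tensor_lift F x) = \sw_(a, b <- x) g (F a b).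
Proof.
move=> hg; rewrite /tensor_lift; elim: (tensor_terms x) => [|p s IHs].
  by rewrite !big_nil (lin_0 hg).
by rewrite !big_cons (lin_add hg) IHs.
Qed.

Lemma lift_exchange V W V' W' U (F : V -> W -> V' -> W' -> U) x y :
  \sw_(a, b <- x) \sw_(c, d <- y) F a b c d =
  \sw_(c, d <- y) \sw_(a, b <- x) F a b c d.
Proof. exact: exchange_big. Qed.

Lemma lift_ten V W (x : tensor V W) : x = \sw_(a, b <- x) (a \ox b).
Proof. exact: tenE. Qed.

Lemma tensor_ext V W U (f g : tensor V W -> U) : islin f -> islin g ->
  (forall v w, f (v \ox w) = g (v \ox w)) -> forall x, f x = g x.
Proof.
by move=> hf hg h x; rewrite [x]lift_ten !lift_push //; apply: eq_lift.
Qed.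

Lemma lift_addF V W U (F G : V -> W -> U) x :
  \sw_(a, b <- x) (F a b + G a b) = tensor_lift F x + tensor_lift G x.
Proof. exact: big_split. Qed.

End LinearLemmas.

Ltac lin1 :=
  match goal with
  | |- bilin _ => split => ?; cbv beta
  | |- forall _, _ => intro; cbv beta
  | |- islin (fun x => x) => exact: lin_id
  | |- islin (fun x => tensor_lift (@?F x) ?t) =>
      refine (@lin_liftF _ _ _ _ _ F t _); cbv beta
  | |- islin (fun x => tensor_lift ?F (@?g x)) =>
      refine (@lin_lift _ _ _ _ _ F g _ _); cbv beta
  | |- islin (fun x => ten (@?f x) ?w) =>
      refine (@lin_tenl _ _ _ _ f w _); cbv beta
  | |- islin (fun x => ten ?v (@?f x)) =>
      refine (@lin_tenr _ _ _ _ f v _); cbv beta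
  | |- islin (fun x => GRing.Linear.sort ?g (@?f x)) =>
      refine (@lin_comp _ _ _ _ g f _); cbv beta
  | |- islin (fun x => GRing.add (@?f x) (@?g x)) =>
      refine (@lin_addf _ _ _ f g _ _); cbv beta
  | |- islin (fun x => GRing.scale ?b (@?f x)) =>
      refine (@lin_scalef _ _ _ f b _); cbv beta
  | |- islin (fun x => GRing.scale (@?f x) ?u) =>
      refine (@lin_scalel _ _ _ f u _); cbv beta
  | |- islin (fun x => GRing.mul (@?f x) ?b) =>
      first [refine (@lin_mulkl _ _ f b _) | refine (@lin_mull _ _ _ f b _)]; cbv beta
  | |- islin (fun x => GRing.mul ?b (@?f x)) =>
      first [refine (@lin_mulkr _ _ f b _) | refine (@lin_mulr _ _ _ f b _)]; cbv beta
  | |- islin ?f =>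
      lazymatch f with (fun _ => _) => fail | _ => change (islin (fun x => f x)) end
  | |- GRing.linear_for _ ?f => change (islin f); cbv beta
  end.
Ltac lin := solve [repeat first [assumption | lin1 ]].

Section TensorAlgebra.
Variables (k : fieldType) (A B : algType k).

Definition tensor_mul (x y : tensor A B) : tensor A B :=
  \sw_(a, b <- x) \sw_(a', b' <- y) ((a * a') \ox (b * b')).

Definition tensor_one : tensor A B := 1 \ox 1.

Lemma tensor_mul_ten a b a' b' :
  tensor_mul (a \ox b) (a' \ox b') = (a * a') \ox (b * b').
Proof. rewrite /tensor_mul !tensor_liftE //; lin. Qed.

Lemma tensor_mul_linl y : linear (tensor_mul^~ y).
Proof. rewrite /tensor_mul; lin. Qed.

Lemma tensor_mul_linr x : linear (tensor_mul x).
Proof. rewrite /tensor_mul; lin. Qed.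

Lemma tensor_mulA : associative tensor_mul.
Proof.
move=> x y z.
apply: (tensor_ext (f := fun x => tensor_mul x (tensor_mul y z))
  (g := fun x => tensor_mul (tensor_mul x y) z)) x => [||a b].
- exact: tensor_mul_linl.
- exact: lin_compf (tensor_mul_linl z) (tensor_mul_linl y).
apply: (tensor_ext (f := fun y => tensor_mul (a \ox b) (tensor_mul y z))
  (g := fun y => tensor_mul (tensor_mul (a \ox b) y) z)) y => [||c d].
- exact: lin_compf (tensor_mul_linr _) (tensor_mul_linl z).
- exact: lin_compf (tensor_mul_linl z) (tensor_mul_linr _).
apply: (tensor_ext (f := fun z => tensor_mul (a \ox b) (tensor_mul (c \ox d) z))
  (g := fun z => tensor_mul (tensor_mul (a \ox b) (c \ox d)) z)) z => [||e f].
- exact: lin_compf (tensor_mul_linr _) (tensor_mul_linr _).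
- exact: tensor_mul_linr.
by rewrite !tensor_mul_ten !mulrA.
Qed.

Lemma tensor_mul1 : left_id tensor_one tensor_mul.
Proof.
apply: (tensor_ext (f := fun x => tensor_mul tensor_one x) (g := id)) => [||a b].
- exact: tensor_mul_linr.
- lin.
- by rewrite tensor_mul_ten !mul1r.
Qed.

Lemma tensor_mulr1 : right_id tensor_one tensor_mul.
Proof.
apply: (tensor_ext (f := fun x => tensor_mul x tensor_one) (g := id)) => [||a b].
- exact: tensor_mul_linl.
- lin.
- by rewrite tensor_mul_ten !mulr1.
Qed.

HB.instance Definition _ := GRing.Zmodule_isPzRing.Build (tensor A B)
  tensor_mulA tensor_mul1 tensor_mulr1
  (fun x y z => lin_add (tensor_mul_linl z) x y)
  (fun x y z => lin_add (tensor_mul_linr x) y z).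

Lemma tenM (a a' : A) (b b' : B) : (a \ox b) * (a' \ox b') = (a * a') \ox (b * b').
Proof. exact: tensor_mul_ten. Qed.
Lemma tenMl (y : tensor A B) : islin (fun x : tensor A B => x * y). Proof. exact: tensor_mul_linl. Qed.
Lemma tenMr (x : tensor A B) : islin (fun y : tensor A B => x * y). Proof. exact: tensor_mul_linr. Qed.

End TensorAlgebra.

Strategy 1000 [tensor_mul tensor_one].

HB.mixin Record Lmodule_isCoalgebra (k : fieldType) C of GRing.Lmodule k C := {
  comul : {linear C -> tensor C C};
  counit : {linear C -> k^o};
  comulA : forall c : C,
    \sw_(c1, c2 <- comul c) \sw_(c11, c12 <- comul c1) (c11 \ox (c12 \ox c2)) =
    \sw_(c1, c2 <- comul c) (c1 \ox comul c2);
  counitl : forall c : C, \sw_(c1, c2 <- comul c) ((counit c1 : k) *: c2) = c;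
  counitr : forall c : C, \sw_(c1, c2 <- comul c) ((counit c2 : k) *: c1) = c;
}.
#[short(type="coalgType")]
HB.structure Definition Coalgebra (k : fieldType) :=
  {C of Lmodule_isCoalgebra k C & GRing.Lmodule k C}.

HB.mixin Record Coalgebra_isBialgebra (k : fieldType) A
    of GRing.Algebra k A & Coalgebra k A := {
  comul1 : comul (1 : A) = 1;
  comulM : forall a b : A, comul (a * b) = comul a * comul b;
  counit1 : counit (1 : A) = 1;
  counitM : forall a b : A, counit (a * b) = counit a * counit b;
}.
#[short(type="bialgType")]
HB.structure Definition Bialgebra (k : fieldType) :=
  {A of Coalgebra_isBialgebra k A & GRing.Algebra k A & Coalgebra k A}.

HB.mixin Record Bialgebra_isHopf (k : fieldType) A of Bialgebra k A := {
  antipode : {linear A -> A};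
  antipodel : forall a : A, \sw_(a1, a2 <- comul a) (antipode a1 * a2) = (counit a)%:A;
  antipoder : forall a : A, \sw_(a1, a2 <- comul a) (a1 * antipode a2) = (counit a)%:A;
}.
#[short(type="hopfAlgType")]
HB.structure Definition HopfAlgebra (k : fieldType) :=
  {A of Bialgebra_isHopf k A & Bialgebra k A}.

Section HopfPairing.
Variables (k : fieldType) (C H : hopfAlgType k).

(* The bilinear form is curried through the tensor product: phi(c, h) is
   phi (c \ox h). *)
Record hopf_pairing := HopfPairing {
  pairing_map :> {linear tensor C H -> k^o};
  pairingMr : forall c h h', pairing_map (c \ox (h * h')) =
    \sw_(c1, c2 <- comul c) (pairing_map (c1 \ox h) * pairing_map (c2 \ox h'));
  pairingMl : forall c c' h, pairing_map ((c * c') \ox h) =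
    \sw_(h1, h2 <- comul h) (pairing_map (c \ox h1) * pairing_map (c' \ox h2));
  pairing1l : forall h, pairing_map (1 \ox h) = counit h;
  pairing1r : forall c, pairing_map (c \ox 1) = counit c;
  pairing_antipode : forall c h, pairing_map (antipode c \ox h) = pairing_map (c \ox antipode h);
}.
End HopfPairing.

Create HintDb islin.

Ltac lin1_hint :=
  match goal with
  | |- islin (fun x => ?g (@?f x)) =>
      refine (@lin_compf _ _ _ _ g f _ _); [solve [auto with islin nocore] | cbv beta]
  | |- islin (fun x => ?g (@?f x) ?c) =>
      refine (@lin_compf _ _ _ _ (fun y => g y c) f _ _);
      [solve [auto with islin nocore] | cbv beta]
  end.
Ltac lin ::= solve [repeat first [assumption | lin1 | lin1_hint]].

Section SweedlerLemmas.
Variable k : fieldType.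
Implicit Types V W U M : lmodType k.

Lemma lift_lift V W V' W' U (F : V -> W -> U) (G : V' -> W' -> tensor V W) x :
  bilin F -> tensor_lift F (tensor_lift G x) = \sw_(a, b <- x) tensor_lift F (G a b).
Proof. by move=> hF; apply: (lift_push (g := tensor_lift F)); apply: tensor_lift_linear. Qed.

Lemma lift_scale V W U (F : V -> W -> U) a x : bilin F ->
  tensor_lift F (a *: x) = a *: tensor_lift F x.
Proof. by move=> hF; apply: lin_scale; apply: tensor_lift_linear. Qed.

Lemma lift_scaler V W U (F : V -> W -> U) a x :
  a *: tensor_lift F x = \sw_(v, w <- x) (a *: F v w).
Proof. by apply: (lift_push (g := fun u => a *: u)); lin. Qed.

Lemma lift_lscale V W U (F : V -> W -> k^o) (u : U) x :
  (tensor_lift F x : k) *: u = \sw_(v, w <- x) ((F v w : k) *: u).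
Proof. by apply: (lift_push (g := fun s : k^o => (s : k) *: u)); lin. Qed.

Section Coalg.
Variable C : coalgType k.
Implicit Types c : C.

Lemma sw_assoc U (F : C -> C -> C -> U) c :
  (forall y z, islin (fun x => F x y z)) -> (forall x z, islin (fun y => F x y z)) ->
  (forall x y, islin (F x y)) ->
  \sw_(a, b <- comul c) \sw_(a1, a2 <- comul a) F a1 a2 b =
  \sw_(a, b <- comul c) \sw_(b1, b2 <- comul b) F a b1 b2.
Proof.
move=> h1 h2 h3.
pose G (t : tensor C (tensor C C)) := \sw_(x, u <- t) tensor_lift (F x) u.
have hF x : bilin (F x) by split => ?; [apply: h2 | apply: h3].
have hB : bilin (fun x u => tensor_lift (F x) u).
  split=> [u|x]; last exact: tensor_lift_linear.
  by apply: lin_liftF => v w; apply: h1.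
have hG : islin G by apply: tensor_lift_linear.
have := congr1 G (comulA c); rewrite !(lift_push _ _ hG).
under eq_lift => a b.
  rewrite (lift_push _ _ hG).
  under eq_lift => x y do rewrite /G !tensor_liftE //.
  over.
move=> ->; apply: eq_lift => a b; by rewrite /G tensor_liftE.
Qed.

Lemma sw_counitl U (f : C -> U) c : islin f ->
  \sw_(a, b <- comul c) ((counit a : k) *: f b) = f c.
Proof.
move=> hf; rewrite -{2}(counitl c) (lift_push _ _ hf).
by apply: eq_lift => a b; rewrite (lin_scale hf).
Qed.

Lemma sw_counitr U (f : C -> U) c : islin f ->
  \sw_(a, b <- comul c) ((counit b : k) *: f a) = f c.
Proof.
move=> hf; rewrite -{2}(counitr c) (lift_push _ _ hf).
by apply: eq_lift => a b; rewrite (lin_scale hf).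
Qed.
End Coalg.

Lemma sw_comulM (A : bialgType k) U (F : A -> A -> U) a b : bilin F ->
  tensor_lift F (comul (a * b)) =
  \sw_(a1, a2 <- comul a) \sw_(b1, b2 <- comul b) F (a1 * b1) (a2 * b2).
Proof.
move=> hF; rewrite comulM.
change (tensor_lift F (tensor_mul (comul a) (comul b)) =
  \sw_(a1, a2 <- comul a) \sw_(b1, b2 <- comul b) F (a1 * b1) (a2 * b2)).
rewrite /tensor_mul lift_lift //; apply: eq_lift => a1 a2.
rewrite lift_lift //; apply: eq_lift => b1 b2.
by rewrite tensor_liftE.
Qed.

Lemma sw_comul1 (A : bialgType k) U (F : A -> A -> U) : bilin F ->
  tensor_lift F (comul 1) = F 1 1.
Proof. by move=> hF; rewrite comul1 tensor_liftE. Qed.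

Section Antipode.
Variable H : hopfAlgType k.
Implicit Types h : H.

Lemma sw_antipodel U (f : H -> U) h : islin f ->
  \sw_(a, b <- comul h) f (antipode a * b) = (counit h : k) *: f 1.
Proof. by move=> hf; rewrite -(lift_push _ _ hf) antipodel (lin_scale hf). Qed.

Lemma sw_antipoder U (f : H -> U) h : islin f ->
  \sw_(a, b <- comul h) f (a * antipode b) = (counit h : k) *: f 1.
Proof. by move=> hf; rewrite -(lift_push _ _ hf) antipoder (lin_scale hf). Qed.

Lemma antipode1 : antipode (1 : H) = 1.
Proof.
have := antipodel (1 : H); rewrite sw_comul1; last lin.
by rewrite mulr1 counit1 scale1r.
Qed.

(* S(h h') = S h' S h: both are convolution inverse to the multiplication. *)
Lemma antipodeM h h' : antipode (h * h') = antipode h' * antipode h.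
Proof.
(* sum over h1 h2 h3, h'1 h'2 h'3 : S(h1h'1) h2 h'2 S h'3 S h3 *)
pose E h h' := \sw_(a, b <- comul h) \sw_(a', b' <- comul h')
  \sw_(b1, b2 <- comul b) \sw_(b'1, b'2 <- comul b')
  (antipode (a * a') * (b1 * b'1) * (antipode b'2 * antipode b2)).
have -> : antipode (h * h') = E h h'.
  transitivity (\sw_(a, b <- comul h) \sw_(a', b' <- comul h')
     ((counit b : k) *: ((counit b' : k) *: antipode (a * a')))).
    rewrite (eq_lift (G := fun a b => (counit b : k) *: antipode (a * h'))).
      by rewrite (sw_counitr (f := fun a => antipode (a * h'))) //; lin.
    move=> a b; rewrite -lift_scaler; congr (_ *: _).
    by rewrite (sw_counitr (f := fun a' => antipode (a * a'))) //; lin.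
  apply: eq_lift => a b; apply: eq_lift => a' b'.
  under [RHS]eq_lift => b1 b2.
    under eq_lift => b'1 b'2.
      rewrite mulrA -[_ * (b1 * b'1) * _]mulrA -[b1 * b'1 * _]mulrA.
      over.
    rewrite (sw_antipoder (f := fun u => antipode (a * a') * (b1 * u) * antipode b2)); last lin.
    rewrite mulr1 -mulrA.
    over.
  rewrite -lift_scaler (sw_antipoder (f := fun u => antipode (a * a') * u)); last lin.
  by rewrite mulr1 scalerA [RHS]scalerA mulrC.
rewrite /E.
under eq_lift => a b.
  rewrite lift_exchange.
  over.
rewrite -(sw_assoc (F := fun a b1 b2 => \sw_(a', b' <- comul h')
  \sw_(b'1, b'2 <- comul b') (antipode (a * a') * (b1 * b'1) * (antipode b'2 * antipode b2)))); try lin.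
under eq_lift => a b.
  under eq_lift => a1 a2.
    rewrite -(sw_assoc (F := fun a' b'1 b'2 =>
       (antipode (a1 * a') * (a2 * b'1) * (antipode b'2 * antipode b)))); try lin.
    over.
  rewrite lift_exchange.
  under eq_lift => a' b'.
    rewrite -(sw_comulM (F := fun x y => antipode x * y * (antipode b' * antipode b)) a a'); last lin.
    rewrite (sw_antipodel (f := fun u => u * (antipode b' * antipode b))); last lin.
    rewrite mul1r counitM -scalerA.
    over.
  rewrite -lift_scaler (sw_counitl (f := fun b' => antipode b' * antipode b)); last lin.
  over.
by rewrite (sw_counitl (f := fun b => antipode h' * antipode b)) //; lin.
Qed.

Lemma counit_antipode h : counit (antipode h) = counit h.
Proof.
rewrite -{1}(counitr h) [LHS](lift_push (g := fun h => counit (antipode h))); last lin.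
have := congr1 (counit : H -> k) (antipodel h).
rewrite linearZ /= counit1 [_ *: 1]mulr1 => <-.
rewrite [RHS](lift_push (g := fun h => counit h : k^o)); last lin.
by apply: eq_lift => a b; rewrite linearZ counitM /= [RHS]mulrC linearZ.
Qed.

End Antipode.
End SweedlerLemmas.

Section Straightening.
Variables (k : fieldType) (C H : hopfAlgType k) (phi : hopf_pairing C H).
Implicit Types (c : C) (h g : H).

(* The element c2 (x) h2 phi(c1, S h1) phi(c3, h3), to which h . c is rewritten
   in the quantum double. *)
Definition straighten h c : tensor C H :=
  \sw_(c1, c' <- comul c) \sw_(c2, c3 <- comul c')
    \sw_(h1, h' <- comul h) \sw_(h2, h3 <- comul h')
      ((phi (c1 \ox antipode h1) * phi (c3 \ox h3) : k) *: (c2 \ox h2)).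

Definition lhit h c : C := \sw_(c1, c2 <- comul c) ((phi (c2 \ox h) : k) *: c1).
Definition rhit c h : C := \sw_(c1, c2 <- comul c) ((phi (c1 \ox h) : k) *: c2).

Lemma lhit_linl c : islin (lhit^~ c). Proof. rewrite /lhit; lin. Qed.
Lemma lhit_linr h : islin (lhit h). Proof. rewrite /lhit; lin. Qed.
Lemma rhit_linl h : islin (rhit^~ h). Proof. rewrite /rhit; lin. Qed.
Lemma rhit_linr c : islin (rhit c). Proof. rewrite /rhit; lin. Qed.
Lemma straighten_linl c : islin (straighten^~ c). Proof. rewrite /straighten; lin. Qed.
Lemma straighten_linr h : islin (straighten h). Proof. rewrite /straighten; lin. Qed.
Hint Resolve lhit_linl lhit_linr rhit_linl rhit_linr straighten_linl straighten_linr : islin.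

Lemma straightenE h c : straighten h c =
  \sw_(h1, h' <- comul h) \sw_(h2, h3 <- comul h')
    (lhit h3 (rhit c (antipode h1)) \ox h2).
Proof.
rewrite /straighten.
under eq_lift => c1 c' do [rewrite lift_exchange; under eq_lift => h1 h' do rewrite lift_exchange].
rewrite lift_exchange; apply: eq_lift => h1 h'.
rewrite lift_exchange; apply: eq_lift => h2 h3.
rewrite [in RHS]/rhit [RHS](lift_push (g := fun x => lhit h3 x \ox h2)); last lin.
apply: eq_lift => c1 c'.
rewrite (lin_scale (lhit_linr h3)) /lhit.
rewrite [RHS](lift_push (g := fun x => ((phi (c1 \ox antipode h1) : k) *: x) \ox h2)); last lin.
apply: eq_lift => c2 c3.
by rewrite scalerA (lin_scale (ten_linearl h2)).
Qed.

Lemma lhitM h g c : lhit (h * g) c = lhit h (lhit g c).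
Proof.
rewrite {1}/lhit.
under eq_lift => c1 c2 do rewrite pairingMr lift_lscale.
rewrite -(sw_assoc (F := fun c1 c21 c22 : C => (phi (c21 \ox h) * phi (c22 \ox g) : k) *: c1)); try lin.
rewrite [lhit g c]/lhit [RHS](lift_push _ _ (lhit_linr h)).
apply: eq_lift => c1 c2; rewrite (lin_scale (lhit_linr h)) /lhit lift_scaler.
by apply: eq_lift => c11 c12; rewrite scalerA mulrC.
Qed.

Lemma rhitM h g c : rhit c (h * g) = rhit (rhit c h) g.
Proof.
rewrite {1}/rhit.
under eq_lift => c1 c2 do rewrite pairingMr lift_lscale.
rewrite (sw_assoc (F := fun c11 c12 c2 : C => (phi (c11 \ox h) * phi (c12 \ox g) : k) *: c2)); try lin.
rewrite [rhit c h]/rhit [RHS](lift_push _ _ (rhit_linl g)).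
apply: eq_lift => c1 c2; rewrite (lin_scale (rhit_linl g)) /rhit lift_scaler.
by apply: eq_lift => c11 c12; rewrite scalerA.
Qed.

Lemma lhit_rhit h g c : lhit h (rhit c g) = rhit (lhit h c) g.
Proof.
rewrite [in LHS]/rhit [in RHS]/lhit (lift_push _ _ (lhit_linr h)) (lift_push _ _ (rhit_linl g)).
under eq_lift => c1 c2 do rewrite (lin_scale (lhit_linr h)) /lhit lift_scaler.
under [RHS]eq_lift => c1 c2 do rewrite (lin_scale (rhit_linl g)) /rhit lift_scaler.
rewrite -(sw_assoc (F := fun c1 c21 c22 : C => (phi (c1 \ox g) : k) *: ((phi (c22 \ox h) : k) *: c21))); try lin.
apply: eq_lift => c1 c2; apply: eq_lift => c11 c12.
by rewrite !scalerA mulrC.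
Qed.

Lemma lhit1 c : lhit 1 c = c.
Proof.
rewrite /lhit; under eq_lift => c1 c2 do rewrite pairing1r.
by rewrite (sw_counitr (f := id)) //; lin.
Qed.

Lemma rhit1 c : rhit c 1 = c.
Proof.
rewrite /rhit; under eq_lift => c1 c2 do rewrite pairing1r.
by rewrite (sw_counitl (f := id)) //; lin.
Qed.

Lemma lhit_one h : lhit h 1 = (counit h : k) *: 1.
Proof. by rewrite /lhit sw_comul1 ?pairing1l //; lin. Qed.

Lemma rhit_one h : rhit 1 h = (counit h : k) *: 1.
Proof. by rewrite /rhit sw_comul1 ?pairing1l //; lin. Qed.

Lemma lhit_mul h c c' :
  lhit h (c * c') = \sw_(h1, h2 <- comul h) (lhit h1 c * lhit h2 c').
Proof.
rewrite /lhit sw_comulM; last lin.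
under eq_lift => c1 c2 do under eq_lift => c1' c2' do rewrite pairingMl lift_lscale.
under eq_lift => c1 c2 do rewrite lift_exchange.
rewrite lift_exchange; apply: eq_lift => h1 h2.
rewrite [RHS](lift_push (g := fun x => x * _)); last lin.
apply: eq_lift => c1 c2.
rewrite [RHS](lift_push (g := fun x => _ * x)); last lin.
apply: eq_lift => c1' c2'.
by rewrite -scalerAl -scalerAr scalerA.
Qed.

Lemma pairing_antipodeM c c' h : phi ((c * c') \ox antipode h) =
  \sw_(h1, h2 <- comul h) (phi (c' \ox antipode h1) * phi (c \ox antipode h2)).
Proof.
rewrite -pairing_antipode antipodeM pairingMl.
by apply: eq_lift => h1 h2; rewrite !pairing_antipode.
Qed.

Lemma rhit_mul h c c' : rhit (c * c') (antipode h) =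
  \sw_(h1, h2 <- comul h) (rhit c (antipode h2) * rhit c' (antipode h1)).
Proof.
rewrite /rhit sw_comulM; last lin.
under eq_lift => c1 c2 do under eq_lift => c1' c2' do rewrite pairing_antipodeM lift_lscale.
under eq_lift => c1 c2 do rewrite lift_exchange.
rewrite lift_exchange; apply: eq_lift => h1 h2.
rewrite [RHS](lift_push (g := fun x => x * _)); last lin.
apply: eq_lift => c1 c2.
rewrite [RHS](lift_push (g := fun x => _ * x)); last lin.
apply: eq_lift => c1' c2'.
by rewrite -scalerAl -scalerAr scalerA mulrC.
Qed.

Lemma straighten1l c : straighten 1 c = c \ox 1.
Proof. rewrite straightenE !sw_comul1 ?antipode1 ?rhit1 ?lhit1 //; lin. Qed.

Lemma straighten1r h : straighten h 1 = 1 \ox h.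
Proof.
rewrite straightenE.
under eq_lift => h1 h'.
  under eq_lift => h2 h3.
    rewrite rhit_one counit_antipode (lin_scale (lhit_linr h3)) lhit_one scalerA.
    rewrite mulrC -scalerA (lin_scale (ten_linearl h2)).
    over.
  rewrite (sw_counitr (f := fun h2 : H => ((counit h1 : k) *: (1 : C)) \ox h2)); last lin.
  rewrite (lin_scale (ten_linearl h')).
  over.
by rewrite (sw_counitl (f := fun h2 : H => (1 : C) \ox h2)) //; lin.
Qed.

Lemma straightenMl h g c : straighten (h * g) c =
  \sw_(a, b <- straighten g c) \sw_(a', b' <- straighten h a) (a' \ox (b' * b)).
Proof.
rewrite !straightenE sw_comulM; last lin.
under eq_lift => h1 h'.
  under eq_lift => g1 g'.
    rewrite sw_comulM; last lin.
    rewrite lift_exchange.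
    over.
  over.
rewrite lift_exchange lift_lift; last lin.
apply: eq_lift => g1 g'.
rewrite lift_lift; last lin.
rewrite lift_exchange; apply: eq_lift => g2 g3.
rewrite tensor_liftE; last lin.
rewrite straightenE lift_lift; last lin.
apply: eq_lift => h1 h'.
rewrite lift_lift; last lin.
apply: eq_lift => h2 h3.
rewrite tensor_liftE; last lin.
by rewrite antipodeM rhitM lhitM [lhit g3 (rhit (rhit _ _) _)]lhit_rhit.
Qed.

Lemma straightenMr h c' c : straighten h (c' * c) =
  \sw_(a, b <- straighten h c) \sw_(a', b' <- straighten b c') ((a' * a) \ox b').
Proof.
pose G x1 x2 x3 x4 x5 : tensor C H :=
  (lhit x4 (rhit c' (antipode x2)) * lhit x5 (rhit c (antipode x1))) \ox x3.
transitivity (\sw_(x1, r1 <- comul h) \sw_(x2, r2 <- comul r1)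
  \sw_(x3, r3 <- comul r2) \sw_(x4, x5 <- comul r3) G x1 x2 x3 x4 x5).
  rewrite straightenE.
  under eq_lift => h1 h'.
    under eq_lift => h2 h3.
      rewrite rhit_mul (lift_push _ _ (lhit_linr h3)).
      rewrite (lift_push (g := fun x => x \ox h2)); last lin.
      under eq_lift => h11 h12.
        rewrite lhit_mul (lift_push (g := fun x => x \ox h2)); last lin.
        over.
      over.
    rewrite lift_exchange.
    over.
  rewrite (sw_assoc (F := fun x1 x2 r2 => \sw_(x3, r3 <- comul r2)
     \sw_(x4, x5 <- comul r3) G x1 x2 x3 x4 x5)) //; rewrite /G; lin.
rewrite straightenE lift_lift; last lin.
apply: eq_lift => h1 h'.
rewrite lift_lift; last lin.
under [RHS]eq_lift => h2 h3.
  rewrite tensor_liftE; last lin.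
  rewrite straightenE lift_lift; last lin.
  under eq_lift => b1 b'.
    rewrite lift_lift; last lin.
    under eq_lift => b2 b3.
      rewrite tensor_liftE; last lin.
      over.
    over.
  over.
rewrite (sw_assoc (F := fun b1 b' h3 => \sw_(b2, b3 <- comul b') G h1 b1 b2 b3 h3)); try by (rewrite /G; lin).
apply: eq_lift => x2 r2.
rewrite (sw_assoc (F := fun b2 b3 h3 => G h1 x2 b2 b3 h3)) //; rewrite /G; lin.
Qed.

End Straightening.
#[export] Hint Resolve lhit_linl lhit_linr rhit_linl rhit_linr straighten_linl straighten_linr : islin.
Strategy 1000 [straighten lhit rhit].

Section LinearOf.
Variables (k : fieldType) (V W : lmodType k) (f : V -> W).
Hypothesis fP : islin f.
HB.instance Definition _ := GRing.isLinear.Build k V W *:%R f fP.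
Definition linear_of : {linear V -> W} := f.
End LinearOf.

Section TensorCoalgebra.
Variables (k : fieldType) (C D : coalgType k).

Definition tensor_comul_fun (x : tensor C D) : tensor (tensor C D) (tensor C D) :=
  \sw_(c, d <- x) \sw_(c1, c2 <- comul c) \sw_(d1, d2 <- comul d)
    ((c1 \ox d1) \ox (c2 \ox d2)).
Definition tensor_counit_fun (x : tensor C D) : k^o :=
  \sw_(c, d <- x) (counit c * counit d).

Lemma tensor_comul_linear : islin tensor_comul_fun.
Proof. rewrite /tensor_comul_fun; lin. Qed.
Lemma tensor_counit_linear : islin tensor_counit_fun.
Proof. rewrite /tensor_counit_fun; lin. Qed.

Definition tensor_comul := linear_of tensor_comul_linear.
Definition tensor_counit := linear_of tensor_counit_linear.

Lemma tensor_comulE c d : tensor_comul (c \ox d) =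
  \sw_(c1, c2 <- comul c) \sw_(d1, d2 <- comul d) ((c1 \ox d1) \ox (c2 \ox d2)).
Proof. rewrite [LHS]tensor_liftE //; lin. Qed.
Lemma tensor_counitE c d : tensor_counit (c \ox d) = counit c * counit d.
Proof. rewrite [LHS]tensor_liftE //; lin. Qed.

Lemma sw_tensor_comul (U : lmodType k) (F : tensor C D -> tensor C D -> U) c d :
  bilin F -> tensor_lift F (tensor_comul (c \ox d)) =
  \sw_(c1, c2 <- comul c) \sw_(d1, d2 <- comul d) F (c1 \ox d1) (c2 \ox d2).
Proof.
move=> hF; rewrite tensor_comulE lift_lift //; apply: eq_lift => c1 c2.
by rewrite lift_lift //; apply: eq_lift => d1 d2; rewrite tensor_liftE.
Qed.

Lemma tensor_coassoc x :
  \sw_(x1, x2 <- tensor_comul x) \sw_(x11, x12 <- tensor_comul x1) (x11 \ox (x12 \ox x2)) =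
  \sw_(x1, x2 <- tensor_comul x) (x1 \ox tensor_comul x2).
Proof.
move: x; apply: tensor_ext => [||c d]; [lin | lin |].
rewrite !sw_tensor_comul; try lin.
transitivity (\sw_(a, b <- comul c) \sw_(a1, a2 <- comul a) \sw_(d1, d2 <- comul d)
   \sw_(e1, e2 <- comul d1) ((a1 \ox e1) \ox ((a2 \ox e2) \ox (b \ox d2)))).
  apply: eq_lift => a b; rewrite [RHS]lift_exchange; apply: eq_lift => d1 d2.
  by rewrite sw_tensor_comul //; lin.
rewrite (sw_assoc (F := fun a1 a2 b => \sw_(d1, d2 <- comul d)
   \sw_(e1, e2 <- comul d1) ((a1 \ox e1) \ox ((a2 \ox e2) \ox (b \ox d2))))); try lin.
apply: eq_lift => a b.
rewrite (eq_lift (G := fun b1 b2 => \sw_(d1, d2 <- comul d) \sw_(e1, e2 <- comul d2)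
   ((a \ox d1) \ox ((b1 \ox e1) \ox (b2 \ox e2))))).
  rewrite lift_exchange; apply: eq_lift => d1 d2.
  rewrite tensor_comulE [RHS](lift_push (g := fun x => (a \ox d1) \ox x)); last lin.
  apply: eq_lift => b1 b2.
  by rewrite [RHS](lift_push (g := fun x => (a \ox d1) \ox x)) //; lin.
move=> b1 b2.
rewrite (sw_assoc (F := fun e1 e2 d2 => (a \ox e1) \ox ((b1 \ox e2) \ox (b2 \ox d2)))) //; lin.
Qed.

Lemma tensor_counitl x :
  \sw_(x1, x2 <- tensor_comul x) ((tensor_counit x1 : k) *: x2) = x.
Proof.
move: x; apply: (tensor_ext (g := id)) => [||c d]; [lin | lin |].
rewrite !sw_tensor_comul; try lin.
under eq_lift => c1 c2.
  under eq_lift => d1 d2.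
    rewrite tensor_counitE mulrC -scalerA.
    over.
  rewrite (sw_counitl (f := fun d2 => (counit c1 : k) *: (c2 \ox d2))); last lin.
  over.
by rewrite (sw_counitl (f := fun c2 => c2 \ox d)) //; lin.
Qed.

Lemma tensor_counitr x :
  \sw_(x1, x2 <- tensor_comul x) ((tensor_counit x2 : k) *: x1) = x.
Proof.
move: x; apply: (tensor_ext (g := id)) => [||c d]; [lin | lin |].
rewrite !sw_tensor_comul; try lin.
under eq_lift => c1 c2.
  under eq_lift => d1 d2.
    rewrite tensor_counitE mulrC -scalerA.
    over.
  rewrite (sw_counitr (f := fun d1 => (counit c2 : k) *: (c1 \ox d1))); last lin.
  over.
by rewrite (sw_counitr (f := fun c1 => c1 \ox d)) //; lin.
Qed.

Strategy 1000 [tensor_comul tensor_counit].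

HB.instance Definition _ := Lmodule_isCoalgebra.Build k (tensor C D)
  tensor_coassoc tensor_counitl tensor_counitr.

Lemma comul_ten (c : C) (d : D) : comul (c \ox d) =
  \sw_(c1, c2 <- comul c) \sw_(d1, d2 <- comul d) ((c1 \ox d1) \ox (c2 \ox d2)).
Proof. exact: tensor_comulE. Qed.

Lemma counit_ten (c : C) (d : D) : counit (c \ox d) = counit c * counit d.
Proof. exact: tensor_counitE. Qed.

End TensorCoalgebra.

(* On the tensor product coalgebra of C and H, the product is the one forced by
   c . c' = c' c, h . h' = h h', c . h = c (x) h and the exchange relation
   h . c = straighten h c, see qd_inlM, qd_inrM, qd_inl_inr and qd_inr_inl.
   The result is a bialgebra for every Hopf pairing.  It is only shown to have
   an antipode when that of C is bijective (qd_antipode), as C^op need not be a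
   Hopf algebra otherwise; hence there is no hopfAlgType instance. *)
Section QuantumDouble.
Variables (k : fieldType) (C H : hopfAlgType k) (phi : hopf_pairing C H).

Definition quantum_double of hopf_pairing C H : Type := tensor C H.
Local Notation D := (quantum_double phi).

HB.instance Definition _ := Coalgebra.on D.

Definition qd_mul (x y : D) : D :=
  \sw_(c, h <- x) \sw_(c', h' <- y)
    \sw_(a, b <- straighten phi h c') ((a * c) \ox (b * h')).
Definition qd_one : D := 1 \ox 1.

Lemma qd_mul_linl (y : D) : islin (fun x : D => qd_mul x y).
Proof. rewrite /qd_mul; lin. Qed.

Lemma qd_mul_linr (x : D) : islin (qd_mul x).
Proof. rewrite /qd_mul; lin. Qed.

Lemma qd_mul_ten c h c' h' : qd_mul (c \ox h) (c' \ox h') =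
  \sw_(a, b <- straighten phi h c') ((a * c) \ox (b * h')).
Proof. rewrite /qd_mul !tensor_liftE //; lin. Qed.

Lemma qd_mulA : associative qd_mul.
Proof.
move=> x y z.
apply: (tensor_ext (f := fun x => qd_mul x (qd_mul y z))
  (g := fun x => qd_mul (qd_mul x y) z)) x => [||c h].
- exact: qd_mul_linl.
- exact: lin_compf (qd_mul_linl z) (qd_mul_linl y).
apply: (tensor_ext (f := fun y => qd_mul (c \ox h) (qd_mul y z))
  (g := fun y => qd_mul (qd_mul (c \ox h) y) z)) y => [||c' h'].
- exact: lin_compf (qd_mul_linr _) (qd_mul_linl z).
- exact: lin_compf (qd_mul_linl z) (qd_mul_linr _).
apply: (tensor_ext (f := fun z => qd_mul (c \ox h) (qd_mul (c' \ox h') z))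
  (g := fun z => qd_mul (qd_mul (c \ox h) (c' \ox h')) z)) z => [||c'' h''].
- exact: lin_compf (qd_mul_linr _) (qd_mul_linr _).
- exact: qd_mul_linr.
rewrite !qd_mul_ten (lift_push _ _ (qd_mul_linr _)) (lift_push _ _ (qd_mul_linl _)).
under eq_lift => p q.
  rewrite qd_mul_ten straightenMr lift_lift; last lin.
  under eq_lift => a b.
    rewrite lift_lift; last lin.
    under eq_lift => p' q' do (rewrite tensor_liftE; last lin).
    over.
  over.
rewrite lift_exchange; apply: eq_lift => a b.
rewrite qd_mul_ten straightenMl [RHS]lift_lift; last lin.
apply: eq_lift => p q; rewrite [RHS]lift_lift; last lin.
apply: eq_lift => p' q'; rewrite tensor_liftE; last lin.
by rewrite !mulrA.
Qed.

Lemma qd_mul1 : left_id qd_one qd_mul.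
Proof.
apply: (tensor_ext (f := fun x => qd_mul qd_one x) (g := id)) => [||c h].
- exact: qd_mul_linr.
- lin.
by rewrite qd_mul_ten straighten1l tensor_liftE ?mulr1 ?mul1r //; lin.
Qed.

Lemma qd_mulr1 : right_id qd_one qd_mul.
Proof.
apply: (tensor_ext (f := fun x => qd_mul x qd_one) (g := id)) => [||c h].
- exact: qd_mul_linl.
- lin.
by rewrite qd_mul_ten straighten1r tensor_liftE ?mulr1 ?mul1r //; lin.
Qed.

Lemma qd_one_neq0 : qd_one != 0.
Proof.
apply/eqP => /(congr1 (counit : D -> k)).
rewrite linear0 [LHS]counit_ten !counit1 mulr1 => /eqP.
by rewrite (negPf (oner_neq0 k)).
Qed.

Strategy 1000 [qd_mul qd_one].

HB.instance Definition _ := GRing.Zmodule_isNzRing.Build D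
  qd_mulA qd_mul1 qd_mulr1
  (fun x y z => lin_add (qd_mul_linl z) x y)
  (fun x y z => lin_add (qd_mul_linr x) y z) qd_one_neq0.

Lemma qd_scalerAl (a : k) (x y : D) : a *: (x * y) = (a *: x) * y.
Proof. by rewrite [RHS](lin_scale (qd_mul_linl y)). Qed.

Lemma qd_scalerAr (a : k) (x y : D) : a *: (x * y) = x * (a *: y).
Proof. by rewrite [RHS](lin_scale (qd_mul_linr x)). Qed.

HB.instance Definition _ := GRing.Lmodule_isLalgebra.Build k D qd_scalerAl.
HB.instance Definition _ := GRing.Lalgebra_isAlgebra.Build k D qd_scalerAr.

End QuantumDouble.

Section QuantumDoubleBialgebra.
Variables (k : fieldType) (C H : hopfAlgType k) (phi : hopf_pairing C H).
Local Notation D := (quantum_double phi).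
Implicit Types (c : C) (h g : H).

Definition qd_inl c : D := c \ox 1.
Definition qd_inr h : D := 1 \ox h.

Lemma qd_mulE c h c' h' : ((c \ox h : D) * (c' \ox h' : D) : D) =
  \sw_(a, b <- straighten phi h c') ((a * c) \ox (b * h')).
Proof. exact: qd_mul_ten. Qed.

Lemma qd_inlM c c' : qd_inl c * qd_inl c' = qd_inl (c' * c).
Proof. by rewrite qd_mulE straighten1l tensor_liftE ?mulr1 //; lin. Qed.

Lemma qd_inrM h h' : qd_inr h * qd_inr h' = qd_inr (h * h').
Proof. by rewrite qd_mulE straighten1r tensor_liftE ?mulr1 //; lin. Qed.

Lemma qd_inl_inr c h : qd_inl c * qd_inr h = c \ox h.
Proof. by rewrite qd_mulE straighten1l tensor_liftE ?mulr1 ?mul1r //; lin. Qed.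

Lemma qd_inr_inl h c : qd_inr h * qd_inl c =
  \sw_(c1, c' <- comul c) \sw_(c2, c3 <- comul c')
    \sw_(h1, h' <- comul h) \sw_(h2, h3 <- comul h')
      ((phi (c1 \ox antipode h1) * phi (c3 \ox h3) : k) *: (qd_inl c2 * qd_inr h2)).
Proof.
rewrite qd_mulE; under eq_lift => a b do rewrite !mulr1.
rewrite -lift_ten /straighten.
do 4 (apply: eq_lift => ? ?); by rewrite qd_inl_inr.
Qed.

Lemma qd_comul1 : comul (1 : D) = 1.
Proof. by rewrite [LHS]comul_ten sw_comul1 ?sw_comul1 //; lin. Qed.

Lemma qd_counit1 : counit (1 : D) = 1.
Proof. by rewrite [LHS]counit_ten !counit1 mulr1. Qed.

Lemma counit_lhit h c : counit (lhit phi h c) = phi (c \ox h).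
Proof.
rewrite /lhit [LHS](lift_push (g := fun c => counit c)); last lin.
under eq_lift => c1 c2 do rewrite linearZ /= [_ *: _]mulrC.
by rewrite (sw_counitl (f := fun c => phi (c \ox h) : k^o)) //; lin.
Qed.

Lemma pairing_rhit c g h : phi (rhit phi c g \ox h) = phi (c \ox (g * h)).
Proof.
rewrite /rhit [LHS](lift_push (g := fun c => phi (c \ox h))); last lin.
rewrite pairingMr; apply: eq_lift => c1 c2.
by rewrite [LHS](lin_scale (f := fun c => phi (c \ox h))) //; lin.
Qed.

Lemma counit_straighten h c : counit (straighten phi h c) = counit c * counit h.
Proof.
rewrite straightenE [LHS](lift_push (g := fun x => counit x)); last lin.
under eq_lift => h1 h'.
  rewrite (lift_push (g := fun x => counit x)); last lin.
  under eq_lift => h2 h3 do rewrite counit_ten counit_lhit pairing_rhit mulrC.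
  rewrite (sw_counitl (f := fun h3 => phi (c \ox (antipode h1 * h3)) : k^o)); last lin.
  over.
by rewrite (sw_antipodel (f := fun u => phi (c \ox u) : k^o)) ?pairing1r 1?[LHS]mulrC //; lin.
Qed.

Lemma qd_counitM (x y : D) : counit (x * y) = counit x * counit y.
Proof.
apply: (tensor_ext (f := fun x : D => counit (x * y) : k^o)
  (g := fun x : D => counit x * counit y : k^o)) x => [||c h]; [lin|lin|].
apply: (tensor_ext (f := fun y : D => counit ((c \ox h : D) * y) : k^o)
  (g := fun y : D => counit (c \ox h : D) * counit y : k^o)) y => [||c' h']; [lin|lin|].
rewrite qd_mulE [LHS](lift_push (g := fun x : D => counit x : k^o)); last lin.
transitivity ((counit (straighten phi h c') : k) * (counit c * counit h')).
  rewrite [in RHS](lift_ten (straighten _ _ _)).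
  rewrite [RHS](lift_push (g := fun x : tensor C H => (counit x : k) * (counit c * counit h') : k^o)); last lin.
  by apply: eq_lift => a b; rewrite !counit_ten !counitM mulrACA.
rewrite counit_straighten !counit_ten.
by rewrite [LHS]mulrC mulrACA [counit h' * _]mulrC mulrACA.
Qed.

Lemma comul_lhit (U : lmodType k) (F : C -> C -> U) h c : bilin F ->
  tensor_lift F (comul (lhit phi h c)) = \sw_(c1, c2 <- comul c) F c1 (lhit phi h c2).
Proof.
move=> hF; have hl x : islin (F^~ x) by apply: hF.1.
have hr x : islin (F x) by apply: hF.2.
rewrite [lhit phi h c]/lhit (lift_push (g := fun c => tensor_lift F (comul c))); last lin.
under eq_lift => a b do rewrite linearZ lift_scale // lift_scaler.
rewrite (sw_assoc (F := fun c1 c2 c3 => (phi (c3 \ox h) : k) *: F c1 c2)); try lin.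
apply: eq_lift => a b; rewrite [in RHS]/lhit [RHS](lift_push _ _ (hr a)).
by apply: eq_lift => b1 b2; rewrite (lin_scale (hr a)).
Qed.

Lemma comul_rhit (U : lmodType k) (F : C -> C -> U) h c : bilin F ->
  tensor_lift F (comul (rhit phi c h)) = \sw_(c1, c2 <- comul c) F (rhit phi c1 h) c2.
Proof.
move=> hF; have hl x : islin (F^~ x) by apply: hF.1.
have hr x : islin (F x) by apply: hF.2.
rewrite [rhit phi c h]/rhit (lift_push (g := fun c => tensor_lift F (comul c))); last lin.
under eq_lift => a b do rewrite linearZ lift_scale // lift_scaler.
rewrite -(sw_assoc (F := fun c1 c2 c3 => (phi (c1 \ox h) : k) *: F c2 c3)); try lin.
apply: eq_lift => a b; rewrite [in RHS]/rhit [RHS](lift_push _ _ (hl b)).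
by apply: eq_lift => b1 b2; rewrite (lin_scale (hl b)).
Qed.

Lemma sw_lhit_rhit (U : lmodType k) (F : C -> C -> U) h c : bilin F ->
  \sw_(c1, c2 <- comul c) F (lhit phi h c1) c2 =
  \sw_(c1, c2 <- comul c) F c1 (rhit phi c2 h).
Proof.
move=> hF; have hl x : islin (F^~ x) by apply: hF.1.
have hr x : islin (F x) by apply: hF.2.
under eq_lift => a b do rewrite [lhit _ _ _]/lhit (lift_push _ _ (hl b)).
under [RHS]eq_lift => a b do rewrite [rhit _ _ _]/rhit (lift_push _ _ (hr a)).
rewrite -(sw_assoc (F := fun c1 c2 c3 => F c1 ((phi (c2 \ox h) : k) *: c3))); try lin.
apply: eq_lift => a b; apply: eq_lift => a1 a2.
by rewrite (lin_scale (hl b)) (lin_scale (hr a1)).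
Qed.

(* Delta (h . c) = (h1 . c1) (x) (h2 . c2), tested on a bilinear map F. *)
Lemma comul_straighten (U : lmodType k) (F : tensor C H -> tensor C H -> U) h c :
  bilin F -> tensor_lift F (comul (straighten phi h c)) =
  \sw_(h1, h2 <- comul h) \sw_(c1, c2 <- comul c)
     F (straighten phi h1 c1) (straighten phi h2 c2).
Proof.
move=> hF; have hl x : islin (F^~ x) by apply: hF.1.
have hr x : islin (F x) by apply: hF.2.
(* h1 (x) h2 (x) h3 (x) h4, with S h1 and h4 acting on c1 and c2 *)
transitivity (\sw_(h1, r1 <- comul h) \sw_(h2, r2 <- comul r1)
  \sw_(h3, h4 <- comul r2) \sw_(c1, c2 <- comul c)
   F (rhit phi c1 (antipode h1) \ox h2) (lhit phi h4 c2 \ox h3)).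
  rewrite straightenE [LHS](lift_push (g := fun x => tensor_lift F (comul x))); last lin.
  apply: eq_lift => h1 r1.
  rewrite (lift_push (g := fun x => tensor_lift F (comul x))); last lin.
  under eq_lift => h2 h3.
    rewrite sw_tensor_comul // lhit_rhit.
    rewrite (comul_rhit (F := fun c1 c2 => \sw_(d1, d2 <- comul h2) F (c1 \ox d1) (c2 \ox d2))); last lin.
    rewrite (comul_lhit (F := fun c1 c2 => \sw_(d1, d2 <- comul h2) F (rhit phi c1 (antipode h1) \ox d1) (c2 \ox d2))); last lin.
    rewrite lift_exchange.
    over.
  rewrite (sw_assoc (F := fun h2 h3 h4 => \sw_(c1, c2 <- comul c)
   F (rhit phi c1 (antipode h1) \ox h2) (lhit phi h4 c2 \ox h3))) //; lin.
pose G x1 x2 x3 x4 x5 x6 := \sw_(c1, c2 <- comul c)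
  F (rhit phi c1 (antipode x1) \ox x2) (lhit phi x6 (rhit phi c2 (x3 * antipode x4)) \ox x5).
transitivity (\sw_(x1, r1 <- comul h) \sw_(x2, r2 <- comul r1) \sw_(x3, r3 <- comul r2)
  \sw_(x4, r4 <- comul r3) \sw_(x5, x6 <- comul r4) G x1 x2 x3 x4 x5 x6).
  apply: eq_lift => x1 r1; apply: eq_lift => x2 r2.
  rewrite -(sw_assoc (F := fun x3 x4 r4 => \sw_(x5, x6 <- comul r4) G x1 x2 x3 x4 x5 x6)); rewrite /G; try lin.
  under [RHS]eq_lift => a b.
    rewrite (sw_antipoder (f := fun u => \sw_(x5, x6 <- comul b) \sw_(c1, c2 <- comul c)
       F (rhit phi c1 (antipode x1) \ox x2) (lhit phi x6 (rhit phi c2 u) \ox x5))); last lin.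
    over.
  rewrite (sw_counitl (f := fun b => \sw_(x5, x6 <- comul b) \sw_(c1, c2 <- comul c)
       F (rhit phi c1 (antipode x1) \ox x2) (lhit phi x6 (rhit phi c2 1) \ox x5))); last lin.
  by do 2 (apply: eq_lift => ? ?); rewrite rhit1.
have -> : \sw_(h1, h2 <- comul h) \sw_(c1, c2 <- comul c)
     F (straighten phi h1 c1) (straighten phi h2 c2) =
   \sw_(h1, h2 <- comul h) \sw_(x1, r1 <- comul h1) \sw_(x2, x3 <- comul r1)
   \sw_(x4, r4 <- comul h2) \sw_(x5, x6 <- comul r4) G x1 x2 x3 x4 x5 x6.
  apply: eq_lift => h1 h2.
  under eq_lift => c1 c2.
    rewrite !straightenE (lift_push _ _ (hl _)).
    under eq_lift => x1 r1.
      rewrite (lift_push _ _ (hl _)).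
      under eq_lift => x2 x3.
        rewrite (lift_push _ _ (hr _)).
        under eq_lift => x4 r4 do rewrite (lift_push _ _ (hr _)).
        rewrite lhit_rhit.
        over.
      over.
    over.
  rewrite lift_exchange; apply: eq_lift => x1 r1.
  rewrite lift_exchange; apply: eq_lift => x2 x3.
  rewrite lift_exchange; apply: eq_lift => x4 r4.
  rewrite lift_exchange; apply: eq_lift => x5 x6.
  rewrite (sw_lhit_rhit (F := fun c1 c2 => F (rhit phi c1 (antipode x1) \ox x2)
    (lhit phi x6 (rhit phi c2 (antipode x4)) \ox x5))); last lin.
  by apply: eq_lift => c1 c2; rewrite rhitM.
rewrite (sw_assoc (F := fun x1 r1 h2 => \sw_(x2, x3 <- comul r1)
   \sw_(x4, r4 <- comul h2) \sw_(x5, x6 <- comul r4) G x1 x2 x3 x4 x5 x6)); rewrite /G; try lin.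
apply: eq_lift => x1 r1.
rewrite (sw_assoc (F := fun x2 x3 h2 => \sw_(x4, r4 <- comul h2) \sw_(x5, x6 <- comul r4)
   \sw_(c1, c2 <- comul c) F (rhit phi c1 (antipode x1) \ox x2)
     (lhit phi x6 (rhit phi c2 (x3 * antipode x4)) \ox x5))) //; lin.
Qed.

Lemma qd_comulM (x y : D) : comul (x * y) = comul x * comul y.
Proof.
apply: (tensor_ext (f := fun x : D => comul (x * y)) (g := fun x : D => comul x * comul y)) x => [|x1 x2 x3|c h].
- lin.
- by rewrite linearP; exact: (tenMl (comul y)).
apply: (tensor_ext (f := fun y : D => comul ((c \ox h : D) * y))
  (g := fun y : D => comul (c \ox h : D) * comul y)) y => [|y1 y2 y3|c' h'].
- lin.
- by rewrite linearP; exact: (tenMr (comul (c \ox h : D))).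
pose F (x y : tensor C H) : tensor D D :=
  \sw_(c1, c2 <- comul c) \sw_(h'1, h'2 <- comul h')
  \sw_(a, b <- x) \sw_(a', b' <- y)
    (((a * c1) \ox (b * h'1) : D) \ox ((a' * c2) \ox (b' * h'2) : D)).
have hF : bilin F by rewrite /F; lin.
transitivity (tensor_lift F (comul (straighten phi h c'))).
  rewrite qd_mulE [LHS](lift_push (g := fun x : D => comul x)); last lin.
  rewrite [in RHS](lift_ten (straighten _ _ _)).
  rewrite [RHS](lift_push (g := fun x => tensor_lift F (comul x))); last lin.
  apply: eq_lift => a b; rewrite sw_tensor_comul // [LHS]comul_ten sw_comulM; last lin.
  apply: eq_lift => a1 a2.
  under eq_lift => c1 c2 do (rewrite sw_comulM; last lin).
  rewrite lift_exchange; apply: eq_lift => b1 b2.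
  apply: eq_lift => c1 c2; apply: eq_lift => h'1 h'2.
  by rewrite !tensor_liftE //; lin.
rewrite comul_straighten //.
have -> : comul (c \ox h : D) * comul (c' \ox h' : D) =
  \sw_(c1, c2 <- comul c) \sw_(h1, h2 <- comul h)
  \sw_(c'1, c'2 <- comul c') \sw_(h'1, h'2 <- comul h')
    (((c1 \ox h1 : D) * (c'1 \ox h'1 : D)) \ox ((c2 \ox h2 : D) * (c'2 \ox h'2 : D))).
  have E a b : comul (a \ox b : D) = \sw_(a1, a2 <- comul a) \sw_(b1, b2 <- comul b)
      ((a1 \ox b1 : D) \ox (a2 \ox b2 : D)) by exact: comul_ten.
  rewrite !E.
  rewrite [LHS](lift_push _ _ (@tenMl k D D _)); apply: eq_lift => c1 c2.
  rewrite [LHS](lift_push _ _ (@tenMl k D D _)); apply: eq_lift => h1 h2.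
  rewrite [LHS](lift_push _ _ (@tenMr k D D _)); apply: eq_lift => c'1 c'2.
  rewrite [LHS](lift_push _ _ (@tenMr k D D _)); apply: eq_lift => h'1 h'2.
  exact: tenM.
rewrite lift_exchange.
under eq_lift => c'1 c'2.
  under eq_lift => h1 h2 do rewrite /F.
  rewrite lift_exchange.
  over.
rewrite lift_exchange; apply: eq_lift => c1 c2.
rewrite [RHS]lift_exchange.
do 3 (apply: eq_lift => ? ?); rewrite !qd_mulE.
rewrite [RHS](lift_push (g := fun x : D => x \ox (_ : D))); last lin.
apply: eq_lift => a b.
by rewrite [RHS](lift_push (g := fun x : D => (_ : D) \ox x)) //; lin.
Qed.

HB.instance Definition _ := Coalgebra_isBialgebra.Build k D
  qd_comul1 qd_comulM qd_counit1 qd_counitM.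

(* The antipode exists as soon as that of C is bijective, in which case
   C^op is a Hopf algebra. *)
Lemma qd_antipode (T : C -> C) : cancel antipode T -> cancel T antipode ->
  exists S : {linear D -> D}, forall x : D,
    \sw_(x1, x2 <- comul x) (S x1 * x2) = (counit x : k) *: (1 : D) /\
    \sw_(x1, x2 <- comul x) (x1 * S x2) = (counit x : k) *: (1 : D).
Proof.
move=> ST TS.
have Tlin : islin T by move=> a x y; apply: (can_inj ST); rewrite linearP !TS.
have Sinj : injective (antipode : C -> C) by apply: can_inj ST.
have T1 : T 1 = 1 by apply: Sinj; rewrite TS antipode1.
have Tl c : \sw_(c1, c2 <- comul c) (c2 * T c1) = (counit c : k) *: (1 : C).
  apply: Sinj; rewrite linearZ /= antipode1 -antipoder (lift_push (g := antipode)); last lin.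
  by apply: eq_lift => a b; rewrite antipodeM TS.
have Tr c : \sw_(c1, c2 <- comul c) (T c2 * c1) = (counit c : k) *: (1 : C).
  apply: Sinj; rewrite linearZ /= antipode1 -antipodel (lift_push (g := antipode)); last lin.
  by apply: eq_lift => a b; rewrite antipodeM TS.
have inl_lin : islin (qd_inl) by rewrite /qd_inl; lin.
have inr_lin : islin (qd_inr) by rewrite /qd_inr; lin.
pose f (x : D) : D := \sw_(c, h <- x) (qd_inr (antipode h) * qd_inl (T c)).
have flin : islin f by rewrite /f; lin.
have fE c h : f (c \ox h) = qd_inr (antipode h) * qd_inl (T c).
  by rewrite /f tensor_liftE //; lin.
have inr1 : qd_inr 1 = 1 by [].
have inl1 : qd_inl 1 = 1 by [].
exists (linear_of flin) => x; split.
  apply: (tensor_ext (f := fun x : D => \sw_(x1, x2 <- comul x) (f x1 * x2))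
    (g := fun x : D => (counit x : k) *: (1 : D))) x => [||c h]; [lin | lin |].
  rewrite [LHS]sw_tensor_comul; last lin.
  rewrite lift_exchange.
  under eq_lift => h1 h2.
    under eq_lift => c1 c2.
      rewrite fE -[c2 \ox h2]qd_inl_inr mulrA -[_ * _ * qd_inl _]mulrA qd_inlM.
      over.
    rewrite -(lift_push (g := fun u => qd_inr (antipode h1) * qd_inl u * qd_inr h2)); last lin.
    rewrite Tl.
    rewrite (lin_scale (f := fun u => qd_inr (antipode h1) * qd_inl u * qd_inr h2)); last lin.
    rewrite inl1 mulr1 qd_inrM.
    over.
  rewrite -lift_scaler (sw_antipodel (f := qd_inr)) // scalerA inr1.
  by congr (_ *: _); rewrite [RHS]counit_ten.
apply: (tensor_ext (f := fun x : D => \sw_(x1, x2 <- comul x) (x1 * f x2))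
    (g := fun x : D => (counit x : k) *: (1 : D))) x => [||c h]; [lin | lin |].
have ml (y : D) : @islin k (tensor C H) D (fun x => (x : D) * y) by apply: qd_mul_linl.
rewrite [LHS]sw_tensor_comul; last lin.
under eq_lift => c1 c2.
  under eq_lift => h1 h2.
    rewrite fE -[c1 \ox h1]qd_inl_inr mulrA -[_ * _ * qd_inr _]mulrA qd_inrM.
    over.
  rewrite (sw_antipoder (f := fun u => qd_inl c1 * qd_inr u * qd_inl (T c2))); last lin.
  rewrite inr1 mulr1 qd_inlM.
  over.
rewrite -lift_scaler -(lift_push (g := qd_inl)) // Tr (lin_scale inl_lin) inl1 scalerA.
by congr (_ *: _); rewrite [RHS]counit_ten mulrC.
Qed.
End QuantumDoubleBialgebra.

(* The full linear dual. *)
Section Dual.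
Variables (k : fieldType) (V : lmodType k).

Record dual := Dual { dual_fun :> V -> k^o; dual_linear : linear dual_fun }.

HB.instance Definition _ (f : dual) :=
  GRing.isLinear.Build k V k^o *:%R f (dual_linear f).

Lemma dual_islin (f : dual) : islin f. Proof. exact: dual_linear. Qed.

HB.instance Definition _ := gen_eqMixin dual.
HB.instance Definition _ := gen_choiceMixin dual.

Lemma dual_ext (f g : dual) : f =1 g -> f = g.
Proof.
case: f g => [f hf] [g hg] /= /funext fg; rewrite fg in hf *.
by rewrite (Prop_irrelevance hf hg).
Qed.

Definition dual_zero := @Dual (fun _ => 0) (fun a x y => esym (etrans (addr0 _) (scaler0 _ a))).

Lemma dual_add_subproof (f g : dual) : linear (fun x => f x + g x).
Proof. by move=> a x y; rewrite !linearP scalerDr addrACA. Qed.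
Definition dual_add f g := Dual (dual_add_subproof f g).

Lemma dual_opp_subproof (f : dual) : linear (fun x => - f x).
Proof. by move=> a x y; rewrite linearP opprD scalerN. Qed.
Definition dual_opp f := Dual (dual_opp_subproof f).

Lemma dual_scale_subproof b (f : dual) : linear (fun x => b *: f x).
Proof. by move=> a x y; rewrite linearP scalerDr !scalerA mulrC. Qed.
Definition dual_scale b f := Dual (dual_scale_subproof b f).

Lemma dual_addA : associative dual_add.
Proof. by move=> f g h; apply: dual_ext => x /=; rewrite addrA. Qed.
Lemma dual_addC : commutative dual_add.
Proof. by move=> f g; apply: dual_ext => x /=; rewrite addrC. Qed.
Lemma dual_add0 : left_id dual_zero dual_add.
Proof. by move=> f; apply: dual_ext => x /=; rewrite add0r. Qed.
Lemma dual_addN : left_inverse dual_zero dual_opp dual_add.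
Proof. by move=> f; apply: dual_ext => x /=; rewrite addNr. Qed.
HB.instance Definition _ :=
  GRing.isZmodule.Build dual dual_addA dual_addC dual_add0 dual_addN.

Lemma dual_scaleA a b f : dual_scale a (dual_scale b f) = dual_scale (a * b) f.
Proof. by apply: dual_ext => x /=; rewrite scalerA. Qed.
Lemma dual_scale1 : left_id 1 dual_scale.
Proof. by move=> f; apply: dual_ext => x /=; rewrite scale1r. Qed.
Lemma dual_scaleDr : right_distributive dual_scale +%R.
Proof. by move=> a f g; apply: dual_ext => x /=; rewrite scalerDr. Qed.
Lemma dual_scaleDl f : {morph dual_scale^~ f : a b / a + b}.
Proof. by move=> a b; apply: dual_ext => x /=; rewrite scalerDl. Qed.
HB.instance Definition _ := GRing.Zmodule_isLmodule.Build k dual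
  dual_scaleA dual_scale1 dual_scaleDr dual_scaleDl.

Lemma dualPE a (f g : dual) x : (a *: f + g) x = a *: f x + g x. Proof. by []. Qed.
End Dual.
#[export] Hint Resolve dual_islin : islin.

Section DualAlgebra.
Variables (k : fieldType) (C : coalgType k).

Lemma dual_mul_subproof (f g : dual C) :
  linear (fun c => \sw_(c1, c2 <- comul c) (f c1 * g c2) : k^o).
Proof. lin. Qed.
Definition dual_mul f g := Dual (dual_mul_subproof f g).
Lemma dual_one_subproof : linear (counit : C -> k^o). Proof. exact: linearP. Qed.
Definition dual_one := Dual dual_one_subproof.

Lemma dual_mulA : associative dual_mul.
Proof.
move=> f g h; apply: dual_ext => c /=.
under eq_lift => a b.
  rewrite (lift_push (g := fun s : k^o => (f a : k) * s : k^o)); last lin.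
  over.
rewrite -(sw_assoc (F := fun a b c => (f a : k) * (g b * h c) : k^o)); try lin.
apply: eq_lift => a b; rewrite [RHS](lift_push (g := fun s : k^o => s * (h b : k) : k^o)); last lin.
by apply: eq_lift => a1 a2; rewrite mulrA.
Qed.
Lemma dual_mul1 : left_id dual_one dual_mul.
Proof. by move=> f; apply: dual_ext => c /=; rewrite (sw_counitl (f := f)) //; lin. Qed.
Lemma dual_mulr1 : right_id dual_one dual_mul.
Proof.
move=> f; apply: dual_ext => c /=.
under eq_lift => a b do rewrite mulrC.
by rewrite (sw_counitr (f := f)) //; lin.
Qed.
Lemma dual_mulDl : left_distributive dual_mul +%R.
Proof.
move=> f g h; apply: dual_ext => c; rewrite /= -[RHS]lift_addF.
by apply: eq_lift => a b; rewrite mulrDl.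
Qed.
Lemma dual_mulDr : right_distributive dual_mul +%R.
Proof.
move=> f g h; apply: dual_ext => c; rewrite /= -[RHS]lift_addF.
by apply: eq_lift => a b; rewrite mulrDr.
Qed.
HB.instance Definition _ := GRing.Zmodule_isPzRing.Build (dual C)
  dual_mulA dual_mul1 dual_mulr1 dual_mulDl dual_mulDr.

Lemma dualME (f g : dual C) c : (f * g) c = \sw_(c1, c2 <- comul c) (f c1 * g c2) :> k^o.
Proof. by []. Qed.
End DualAlgebra.

HB.mixin Record Lmodule_isBimodule (k : fieldType) (A : algType k) M
    of GRing.Lmodule k M := {
  lact : A -> M -> M;
  ract : M -> A -> M;
  lact_linearl : forall m, linear (lact^~ m);
  lact_linearr : forall x, linear (lact x);
  ract_linearl : forall x, linear (ract^~ x);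
  ract_linearr : forall m, linear (ract m);
  lact1 : forall m, lact 1 m = m;
  ract1 : forall m, ract m 1 = m;
  lactM : forall x y m, lact (x * y) m = lact x (lact y m);
  ractM : forall m x y, ract m (x * y) = ract (ract m x) y;
  lactA : forall x m y, lact x (ract m y) = ract (lact x m) y;
}.
#[short(type="bimodType")]
HB.structure Definition Bimodule (k : fieldType) (A : algType k) :=
  {M of Lmodule_isBimodule k A M & GRing.Lmodule k M}.

Definition subbimod_closed (k : fieldType) (A : algType k) (M : bimodType A)
    (S : {pred M}) : Prop :=
  [/\ GRing.submod_closed S,
      forall x : A, {in S, forall m, lact x m \in S} &
      forall x : A, {in S, forall m, ract m x \in S}].

Section DualBimodule.
Variables (k : fieldType) (A : algType k).

Lemma dual_lact_subproof (x : A) (f : dual A) : linear (fun y => f (y * x)).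
Proof. lin. Qed.
Lemma dual_ract_subproof (f : dual A) (x : A) : linear (fun y => f (x * y)).
Proof. lin. Qed.
Definition dual_lact x f : dual A := Dual (dual_lact_subproof x f).
Definition dual_ract f x : dual A := Dual (dual_ract_subproof f x).

Lemma dual_lact_linearl f : linear (dual_lact^~ f).
Proof. by move=> a x y; apply: dual_ext => z /=; rewrite mulrDr -scalerAr linearP. Qed.
Lemma dual_lact_linearr x : linear (dual_lact x).
Proof. by move=> a f g; apply: dual_ext. Qed.
Lemma dual_ract_linearl x : linear (dual_ract^~ x).
Proof. by move=> a f g; apply: dual_ext. Qed.
Lemma dual_ract_linearr f : linear (dual_ract f).
Proof. by move=> a x y; apply: dual_ext => z /=; rewrite mulrDl -scalerAl linearP. Qed.
Lemma dual_lact1 f : dual_lact 1 f = f.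
Proof. by apply: dual_ext => y /=; rewrite mulr1. Qed.
Lemma dual_ract1 f : dual_ract f 1 = f.
Proof. by apply: dual_ext => y /=; rewrite mul1r. Qed.
Lemma dual_lactM x y f : dual_lact (x * y) f = dual_lact x (dual_lact y f).
Proof. by apply: dual_ext => z /=; rewrite mulrA. Qed.
Lemma dual_ractM f x y : dual_ract f (x * y) = dual_ract (dual_ract f x) y.
Proof. by apply: dual_ext => z /=; rewrite mulrA. Qed.
Lemma dual_lactA x f y : dual_lact x (dual_ract f y) = dual_ract (dual_lact x f) y.
Proof. by apply: dual_ext => z /=; rewrite mulrA. Qed.

HB.instance Definition _ := Lmodule_isBimodule.Build k A (dual A)
  dual_lact_linearl dual_lact_linearr dual_ract_linearl dual_ract_linearr
  dual_lact1 dual_ract1 dual_lactM dual_ractM dual_lactA.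
End DualBimodule.

Section Embedding.
Variables (k : fieldType) (C H : hopfAlgType k) (phi : hopf_pairing C H).
Local Notation D := (quantum_double phi).

Definition dual_of_tensor_fun (u : tensor H C) (x : D) : k^o :=
  \sw_(c, h <- x) \sw_(h', c' <- u) (phi (c \ox h') * phi (c' \ox h)).

Lemma dual_of_tensor_linear u : linear (dual_of_tensor_fun u).
Proof.
change (@islin k (tensor C H) _ (dual_of_tensor_fun u)); rewrite /dual_of_tensor_fun; lin.
Qed.

Definition dual_of_tensor (u : tensor H C) : dual D :=
  Dual (dual_of_tensor_linear u).

(* <c.h, h' (x) c'> = phi(c,h') phi(c',h) *)
Lemma dual_of_tensorE c h h' c' :
  dual_of_tensor (h' \ox c') (qd_inl phi c * qd_inr phi h) = phi (c \ox h') * phi (c' \ox h).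
Proof.
by rewrite qd_inl_inr /= /dual_of_tensor_fun !tensor_liftE //; lin.
Qed.

(* When phi is degenerate this is the image of H (x) C, not a copy of it. *)
Definition tensor_in_dual : {pred dual D} :=
  fun f => `[< exists u : tensor H C, f = dual_of_tensor u >].

Lemma dual_of_tensor_islin : islin dual_of_tensor.
Proof.
move=> a u v; apply: dual_ext => x /=; rewrite /dual_of_tensor_fun.
have : islin (fun u => dual_of_tensor_fun u x) by rewrite /dual_of_tensor_fun; lin.
by apply.
Qed.

Lemma dual_of_tensorM u v : dual_of_tensor (u * v) = dual_of_tensor u * dual_of_tensor v.
Proof.
apply: dual_ext.
apply: (tensor_ext (f := dual_of_tensor (u * v) : D -> k^o)
  (g := (dual_of_tensor u * dual_of_tensor v : dual D) : D -> k^o)) => [||c h];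
  [exact: dual_linear | exact: dual_linear |].
rewrite dualME [RHS]sw_tensor_comul; last first.
  by split=> [x|x]; [apply: (@lin_mulkl k (tensor C H))|apply: (@lin_mulkr k (tensor C H))]; exact: dual_linear.
have E w c0 h0 : dual_of_tensor w (c0 \ox h0) = \sw_(h', c' <- w) (phi (c0 \ox h') * phi (c' \ox h0)) :> k^o.
  by rewrite /= /dual_of_tensor_fun tensor_liftE //; lin.
rewrite E.
have -> : u * v = \sw_(a, b <- u) \sw_(a', b' <- v) ((a * a') \ox (b * b')) by [].
rewrite lift_lift; last lin.
under [RHS]eq_lift => c1 c2.
  under eq_lift => h1 h2.
    rewrite !E (lift_push (g := fun s : k^o => (s : k) * _ : k^o)); last lin.
    under eq_lift => a b do (rewrite (lift_push (g := fun s : k^o => _ * (s : k) : k^o)); last lin).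
    over.
  rewrite lift_exchange; over.
rewrite [RHS]lift_exchange; apply: eq_lift => a b.
rewrite lift_lift; last lin.
under [RHS]eq_lift => c1 c2 do rewrite lift_exchange.
rewrite [RHS]lift_exchange; apply: eq_lift => a' b'.
rewrite tensor_liftE; last lin.
rewrite pairingMr pairingMl [LHS](lift_push (g := fun s : k^o => (s : k) * _ : k^o)); last lin.
apply: eq_lift => c1 c2.
rewrite (lift_push (g := fun s : k^o => _ * (s : k) : k^o)); last lin.
by apply: eq_lift => h1 h2; rewrite mulrACA.
Qed.

Lemma dual_of_tensor1 : dual_of_tensor 1 = 1.
Proof.
apply: dual_ext.
apply: (tensor_ext (f := dual_of_tensor 1 : D -> k^o)
  (g := (1 : dual D) : D -> k^o)) => [||c h];
  [exact: dual_linear | exact: dual_linear |].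
rewrite [RHS]counit_ten /= /dual_of_tensor_fun tensor_liftE; last lin.
by rewrite [LHS]tensor_liftE ?pairing1l ?pairing1r //; lin.
Qed.

Lemma tensor_in_dual_submod : GRing.submod_closed tensor_in_dual.
Proof.
split; first by apply/asboolP; exists 0; rewrite (lin_0 dual_of_tensor_islin).
move=> a f g /asboolP[u ->] /asboolP[v ->]; apply/asboolP.
by exists (a *: u + v); rewrite dual_of_tensor_islin.
Qed.

Lemma tensor_in_dual_subring : GRing.subring_closed tensor_in_dual.
Proof.
split.
- by apply/asboolP; exists 1; rewrite dual_of_tensor1.
- exact: (GRing.submod_closedB tensor_in_dual_submod).2.
- move=> f g /asboolP[u ->] /asboolP[v ->]; apply/asboolP.
  by exists (u * v); rewrite dual_of_tensorM.
Qed.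
End Embedding.

Arguments dual_of_tensor {k C H} phi u.
Arguments tensor_in_dual {k C H} phi f.

(* Main.v *)
Require Import Defs.
From mathcomp Require Import all_boot all_algebra.
From mathcomp Require Import boolp.

(** As c . h = [qd_inl c * qd_inr h] spans the double, it is enough to let each
    of the two factors act, on either side, on the functionals <-, h' (x) c'>.
    One evaluates at a . g and moves everything except a and g to the other side
    of the pairing.  With x > f and f < x for the two actions, this gives

      (h' (x) c') < c = h'_(1) phi(c, h'_(2)) (x) c'
      h > (h' (x) c') = h' (x) c'_(1) phi(c'_(2), h)
      c > (h' (x) c') = h'_(2) phi(c_(2), h'_(1)) (x) S(c_(1)) c' c_(3)
      (h' (x) c') < h = S(h_(1)) h' h_(3) (x) phi(c'_(1), h_(2)) c'_(2)

    The first two only involve the product inside C^op or H, see [ract_inl] and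
    [lact_inr].  The last two, [lact_inl] and [ract_inr], are where the exchange
    relation enters.  In g . c it produces phi(c_(1), S g_(1)) and
    phi(c_(3), g_(3)); the former is phi(S c_(1), g_(1)), so both recombine with
    phi(c', g_(2)) into the single value phi(S(c_(1)) c' c_(3), g).  Dually, in
    h . a the factors phi(a_(1), S h_(1)) and phi(a_(3), h_(3)) recombine with
    phi(a_(2), h') into phi(a, S(h_(1)) h' h_(3)).  Since a and g then occur in
    one factor each, the result is a finite sum of pure tensors. *)

Set Implicit Arguments.
Unset Strict Implicit.
Unset Printing Implicit Defensive.

Import GRing.Theory.
Local Open Scope ring_scope.

Section PairingTransposes.
Variables (k : fieldType) (C H : hopfAlgType k) (phi : hopf_pairing C H).
Implicit Types (c a : C) (h g : H).

Definition left_contract c h : H :=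
  \sw_(h1, h2 <- comul h) ((phi (c \ox h1) : k) *: h2).
Definition right_contract c h : H :=
  \sw_(h1, h2 <- comul h) ((phi (c \ox h2) : k) *: h1).

Lemma pairing_left_contract c a h :
  phi (a \ox left_contract c h) = phi ((c * a) \ox h).
Proof.
rewrite /left_contract [LHS](lift_push (g := fun h => phi (a \ox h))); last lin.
rewrite pairingMl; apply: eq_lift => h1 h2.
by rewrite [LHS](lin_scale (f := fun h => phi (a \ox h))) //; lin.
Qed.

Lemma pairing_right_contract c a h :
  phi (a \ox right_contract c h) = phi ((a * c) \ox h).
Proof.
rewrite /right_contract [LHS](lift_push (g := fun h => phi (a \ox h))); last lin.
rewrite pairingMl; apply: eq_lift => h1 h2.
by rewrite [LHS](lin_scale (f := fun h => phi (a \ox h))) 1?[LHS]mulrC //; lin.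
Qed.

Lemma pairing_lhit g c h : phi (lhit phi g c \ox h) = phi (c \ox (h * g)).
Proof.
rewrite /lhit [LHS](lift_push (g := fun c => phi (c \ox h))); last lin.
rewrite pairingMr; apply: eq_lift => c1 c2.
by rewrite [LHS](lin_scale (f := fun c => phi (c \ox h))) 1?[LHS]mulrC //; lin.
Qed.

End PairingTransposes.

Section DualOfTensor.
Variables (k : fieldType) (C H : hopfAlgType k) (phi : hopf_pairing C H).
Local Notation D := (quantum_double phi).
Implicit Types (c a : C) (h g : H) (f : dual D).

Lemma dual_of_tensor_ten c h a g :
  dual_of_tensor phi (h \ox c) (a \ox g) = phi (a \ox h) * phi (c \ox g) :> k.
Proof. by rewrite /= /dual_of_tensor_fun !tensor_liftE //; lin. Qed.

Lemma dual_of_tensor_lin_at (x : D) :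
  islin (fun u : tensor H C => dual_of_tensor phi u x : k^o).
Proof. by rewrite /= /dual_of_tensor_fun; lin. Qed.

Lemma qd_dual_ext f f' :
  (forall a g, f (a \ox g) = f' (a \ox g)) -> f = f'.
Proof.
move=> ff'; apply: dual_ext.
by apply: (tensor_ext (f := f : D -> k^o) (g := f' : D -> k^o)) => //;
  exact: dual_linear.
Qed.

Lemma dual_lift (V W : lmodType k) (F : V -> W -> D) f x :
  f (tensor_lift F x) = \sw_(v, w <- x) f (F v w) :> k^o.
Proof. exact: (lift_push (g := f : D -> k^o) F x (@dual_linear _ _ f)). Qed.

Lemma lact_dualE (x y : D) f : lact x f y = f (y * x). Proof. by []. Qed.
Lemma ract_dualE (x y : D) f : ract f x y = f (x * y). Proof. by []. Qed.

(** In c . a . g the product c . a is a c in C, since C enters the double with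
    its opposite product: hence the contraction on the right. *)
Lemma ract_inl c h' c' :
  ract (dual_of_tensor phi (h' \ox c')) (qd_inl phi c) =
  dual_of_tensor phi (right_contract phi c h' \ox c').
Proof.
apply: qd_dual_ext => a g; rewrite dual_of_tensor_ten pairing_right_contract.
rewrite ract_dualE.
rewrite qd_mulE straighten1l tensor_liftE; last lin.
by rewrite mul1r dual_of_tensor_ten.
Qed.

Lemma lact_inr h h' c' :
  lact (qd_inr phi h) (dual_of_tensor phi (h' \ox c')) =
  dual_of_tensor phi (h' \ox lhit phi h c').
Proof.
apply: qd_dual_ext => a g; rewrite dual_of_tensor_ten pairing_lhit.
rewrite lact_dualE.
rewrite qd_mulE straighten1r tensor_liftE; last lin.
by rewrite mul1r dual_of_tensor_ten.
Qed.

(** The products a . g . c yield one factor in c_(2) a and h', and three factors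
    in the parts of g; the latter are the expansion of a pairing of g with
    S(c_(1)) c' c_(3). *)
Lemma lact_inl c h' c' :
  lact (qd_inl phi c) (dual_of_tensor phi (h' \ox c')) =
  dual_of_tensor phi
    (\sw_(c1, r <- comul c) \sw_(c2, c3 <- comul r)
       (left_contract phi c2 h' \ox (antipode c1 * (c' * c3)))).
Proof.
apply: qd_dual_ext => a g.
rewrite lact_dualE.
rewrite qd_mulE dual_lift.
under eq_lift => p q do rewrite mulr1 dual_of_tensor_ten.
rewrite /straighten lift_lift; last lin.
rewrite [RHS](lift_push _ _ (dual_of_tensor_lin_at _)); apply: eq_lift => c1 r.
rewrite lift_lift; last lin.
rewrite [RHS](lift_push _ _ (dual_of_tensor_lin_at _)); apply: eq_lift => c2 c3.
rewrite dual_of_tensor_ten pairing_left_contract [X in _ * X]pairingMl.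
rewrite [RHS](lift_push (g := fun s : k^o => _ * (s : k) : k^o)); last lin.
rewrite lift_lift; last lin.
apply: eq_lift => g1 g'; rewrite [X in _ * (_ * X)]pairingMl.
rewrite [RHS](lift_push (g := fun s : k^o => _ * (_ * (s : k)) : k^o)); last lin.
rewrite lift_lift; last lin.
apply: eq_lift => g2 g3; rewrite lift_scale ?tensor_liftE; try lin.
(* phi(S c_(1), g_(1)) = phi(c_(1), S g_(1)) *)
rewrite pairing_antipode [LHS]mulrC -!mulrA; congr (_ * _).
by rewrite mulrCA.
Qed.

(** In the form [straightenE] of the exchange relation, h . a is
    h_(3) acting on the left and S h_(1) on the right of a, and both actions are
    transposes of multiplications in H. *)
Lemma ract_inr h h' c' :
  ract (dual_of_tensor phi (h' \ox c')) (qd_inr phi h) =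
  dual_of_tensor phi
    (\sw_(h1, r <- comul h) \sw_(h2, h3 <- comul r)
       ((antipode h1 * (h' * h3)) \ox rhit phi c' h2)).
Proof.
apply: qd_dual_ext => a g.
rewrite ract_dualE.
rewrite qd_mulE dual_lift.
under eq_lift => p q do rewrite mulr1 dual_of_tensor_ten.
rewrite straightenE lift_lift; last lin.
rewrite [RHS](lift_push _ _ (dual_of_tensor_lin_at _)); apply: eq_lift => h1 r.
rewrite lift_lift; last lin.
rewrite [RHS](lift_push _ _ (dual_of_tensor_lin_at _)); apply: eq_lift => h2 h3.
rewrite tensor_liftE; last lin.
by rewrite dual_of_tensor_ten pairing_lhit !pairing_rhit.
Qed.

Lemma dual_of_tensor_in u : dual_of_tensor phi u \in tensor_in_dual phi.
Proof. by apply/asboolP; exists u. Qed.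

Lemma tensor_in_dual_lift (V W : lmodType k) (F : V -> W -> dual D) x :
  (forall v w, F v w \in tensor_in_dual phi) ->
  tensor_lift F x \in tensor_in_dual phi.
Proof.
have [S0 SD] := tensor_in_dual_submod phi.
move=> FS; rewrite /tensor_lift.
elim/big_ind: _ => // f f' fS f'S; rewrite -[f]scale1r; exact: SD.
Qed.

Lemma tensor_in_dual_stable (T : dual D -> dual D) : islin T ->
  (forall h c, T (dual_of_tensor phi (h \ox c)) \in tensor_in_dual phi) ->
  {in tensor_in_dual phi, forall f, T f \in tensor_in_dual phi}.
Proof.
move=> Tlin TS _ /asboolP[u ->]; rewrite [u]lift_ten.
rewrite (lift_push _ _ (dual_of_tensor_islin phi)) (lift_push _ _ Tlin).
exact: tensor_in_dual_lift.
Qed.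

Lemma lact_tensor_in_dual (x : D) :
  {in tensor_in_dual phi, forall f, lact x f \in tensor_in_dual phi}.
Proof.
move=> f fS; rewrite [x]lift_ten.
rewrite [X in X \in _](lift_push (g := fun y : D => lact y f)); last exact: lact_linearl.
apply: tensor_in_dual_lift => c h; rewrite -qd_inl_inr lactM.
apply: tensor_in_dual_stable => [|h' c'|].
- exact: lact_linearr.
- by rewrite lact_inl dual_of_tensor_in.
apply: tensor_in_dual_stable fS => [|h' c']; first exact: lact_linearr.
by rewrite lact_inr dual_of_tensor_in.
Qed.

Lemma ract_tensor_in_dual (x : D) :
  {in tensor_in_dual phi, forall f, ract f x \in tensor_in_dual phi}.
Proof.
move=> f fS; rewrite [x]lift_ten.
rewrite [X in X \in _](lift_push (g := fun y : D => ract f y)); last exact: ract_linearr.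
apply: tensor_in_dual_lift => c h; rewrite -qd_inl_inr ractM.
apply: (tensor_in_dual_stable (T := fun f => ract f _)) => [|h' c'|].
- exact: ract_linearl.
- by rewrite ract_inr dual_of_tensor_in.
apply: (tensor_in_dual_stable (T := fun f => ract f _)) fS => [|h' c'].
  exact: ract_linearl.
by rewrite ract_inl dual_of_tensor_in.
Qed.

End DualOfTensor.

Theorem theorem1p7 (k : fieldType) (H C : hopfAlgType k)
    (phi : hopf_pairing C H) :
  subbimod_closed (A := quantum_double phi) (M := dual (quantum_double phi))
    (tensor_in_dual phi).
Proof.
split; first exact: tensor_in_dual_submod.
- exact: lact_tensor_in_dual.
- exact: ract_tensor_in_dual.
Qed.
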